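(* For every local randomizer $\mathcal{R}:\mathbb{X}\to\mathbb{Y}$, all $x_1^0,x_1^1\in\mathbb{X}$ and $n\ge1$, and any general clone decomposition of $\mathcal{R}$ with respect to $(x_1^0,x_1^1)$, with reduction pair $(P_0^{\mathsf{GC}},P_1^{\mathsf{GC}})$, there is a (possibly randomized) post-processing function $f$ from $(P_0^{\mathsf{GC}},P_1^{\mathsf{GC}})$ to the privacy blanket reduction pair $(P_0^{\mathsf{B}},P_1^{\mathsf{B}})$, i.e. $f(P_0^{\mathsf{GC}})=P_0^{\mathsf{B}}$ and $f(P_1^{\mathsf{GC}})=P_1^{\mathsf{B}}$ in distribution. Therefore, for all $\varepsilon\ge0$ and all neighboring datasets $X_0=(x_1^0,x_2,\dots,x_n)$, $X_1=(x_1^1,x_2,\dots,x_n)$ in $\mathbb{X}^n$, $$D_{e^\varepsilon}\big(\mathcal{M}_S(X_0)\,\|\,\mathcal{M}_S(X_1)\big)\le D_{e^\varepsilon}\big(P_0^{\mathsf{B}}\,\|\,P_1^{\mathsf{B}}\big)\le D_{e^\varepsilon}\big(P_0^{\mathsf{GC}}\,\|\,P_1^{\mathsf{GC}}\big).$$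
   Context: A local randomizer $\mathcal{R}:\mathbb{X}\to\mathbb{Y}$ is a randomized map; $\mathcal{R}(x)$ is its output distribution on input $x$ and $\mathcal{R}(x)(y)$ its density at $y$ with respect to a fixed reference measure on $\mathbb{Y}$ (counting measure if $\mathbb{Y}$ is discrete); $y\mapsto\inf_x\mathcal{R}(x)(y)$ is assumed measurable. Identities between distributions on $\mathbb{Y}$ in a decomposition are understood as pointwise identities of densities. Hockey-stick divergence: $D_\alpha(P\|Q)=\int\max\{0,P(x)-\alpha Q(x)\}\,dx$, with $P(\cdot),Q(\cdot)$ densities with respect to a common reference measure. Shuffling: $\mathcal{M}_S(x_1,\dots,x_n)=\mathcal{S}(\mathcal{R}(x_1),\dots,\mathcal{R}(x_n))$, the $\mathcal{R}(x_i)$ sampled independently and $\mathcal{S}$ applying an independent uniformly random permutation. General clone decomposition with respect to $(x_1^0,x_1^1)$: an integer $k\ge1$, probability distributions $Q_1^1,\dots,Q_1^k$ on $\mathbb{Y}$, non-negative coefficients $a_j,b_j,c_j$ ($j\le k$) and $\beta$ with $\sum_j a_j=\sum_j b_j=\beta+\sum_j c_j=1$, and for each $x\in\mathbb{X}$ a probability distribution $\mathrm{LO}(x)$ on $\mathbb{Y}$, such that $$\mathcal{R}(x_1^0)=\sum_j a_jQ_1^j,\qquad \mathcal{R}(x_1^1)=\sum_j b_jQ_1^j,\qquad \mathcal{R}(x)=\sum_j c_jQ_1^j+\beta\,\mathrm{LO}(x)\ \text{ for all }x\in\mathbb{X}$$ (one writes $Q_i=\mathrm{LO}(x_i)$ for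 the users $i=2,\dots,n$). Reduction pair: let $A_0,A_1,A_2$ be distributions on $\{1,\dots,k+1\}$ with $\Pr[A_0=j]=a_j$, $\Pr[A_1=j]=b_j$, $\Pr[A_2=j]=c_j$ for $j\le k$, and $\Pr[A_0=k+1]=\Pr[A_1=k+1]=0$, $\Pr[A_2=k+1]=\beta$. For $a\in\{0,1\}$, $P_a^{\mathsf{GC}}$ is the distribution of the histogram $(n_1,\dots,n_{k+1})$ of $n$ independent samples, one from $A_a$ and $n-1$ from $A_2$. Privacy blanket reduction pair: $\gamma=\int\inf_{x\in\mathbb{X}}\mathcal{R}(x)(y)\,dy$ and $\omega(y)=\inf_{x\in\mathbb{X}}\mathcal{R}(x)(y)/\gamma$ ($\omega$ arbitrary, and irrelevant, if $\gamma=0$). For $a\in\{0,1\}$, $P_a^{\mathsf{B}}$ is the distribution of $(|\boldsymbol b|,Y^a_{|\boldsymbol b|})$, where $|\boldsymbol b|\sim\mathrm{Bin}(n-1,\gamma)$ and, given $|\boldsymbol b|=m$, $Y^a_m$ is the multiset consisting of one sample from $\mathcal{R}(x_1^a)$ and $m$ independent samples from $\omega$. *)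

(* Defs.v *)
From HB Require Import structures.
From mathcomp Require Import all_boot all_order all_algebra all_fingroup finmap multiset.
From mathcomp Require Import all_classical all_reals all_analysis measurable_realfun.

Set Implicit Arguments.
Unset Strict Implicit.
Unset Printing Implicit Defensive.

Import Order.TTheory GRing.Theory Num.Theory.
Import numFieldNormedType.Exports.

Local Open Scope classical_set_scope.
Local Open Scope ring_scope.

HB.instance Definition _ n := isPointed.Build 'I_n.+1 ord0.
HB.instance Definition _ n := @isMeasurable.Build default_measure_display
  'I_n.+1 (@discrete_measurable 'I_n.+1) (@discrete_measurable0 _)
  (@discrete_measurableC _) (@discrete_measurableU _).

Section multisets.
Context d (Y : measurableType d).

Definition mset_of := {mset Y}%mset.

HB.instance Definition _ := Choice.on mset_of.
HB.instance Definition _ := isPointed.Build mset_of mset0.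

(* Final sigma-algebra of the maps seq_mset : Y^m -> {mset Y}: an event on
   multisets is measurable when it is, for every m, a (symmetric) measurable
   set of m-tuples. *)
Definition mset_measurable : set (set mset_of) :=
  [set A | forall m, measurable [set t : m.-tuple Y | A (seq_mset t)]].

Let mset_measurable0 : mset_measurable set0.
Proof. by move=> m; exact: measurable0. Qed.

Let mset_measurableC A : mset_measurable A -> mset_measurable (~` A).
Proof. by move=> mA m; exact: (measurableC (mA m)). Qed.

Let mset_measurableU (F : (set mset_of)^nat) :
  (forall i, mset_measurable (F i)) -> mset_measurable (\bigcup_i F i).
Proof. by move=> mF m; exact: (bigcup_measurable (fun i _ => mF i m)). Qed.

HB.instance Definition _ := @isMeasurable.Build default_measure_display
  mset_of mset_measurable mset_measurable0 mset_measurableC mset_measurableU.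

End multisets.

Section finite_mixtures.
Context (R : realType).

Record fdist (I : finType) := FDist {
  fdist_weight :> I -> R;
  fdist_ge0 : forall i, 0 <= fdist_weight i;
  fdist_sum1 : \sum_i fdist_weight i = 1 }.

Lemma fdist_uniform_ge0 (I : finType) (i : I) : 0 <= (#|I|%:R : R)^-1.
Proof. by rewrite invr_ge0. Qed.

Lemma fdist_uniform_sum1 (I : finType) (i0 : I) : \sum_(i : I) (#|I|%:R : R)^-1 = 1.
Proof.
rewrite sumr_const -[_ *+ _]mulr_natr mulVf// pnatr_eq0 -lt0n.
by apply/card_gt0P; exists i0.
Qed.

Definition fdist_uniform (I : finType) (i0 : I) : fdist I :=
  FDist (@fdist_uniform_ge0 I) (fdist_uniform_sum1 i0).

Context d (T : measurableType d) (I : finType).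

Definition mixture (p : fdist I) (P : I -> probability T R) (A : set T) : \bar R :=
  (\sum_(i : I) (p i)%:E * P i A)%E.

Variables (p : fdist I) (P : I -> probability T R).

Let mixture0 : mixture p P set0 = 0%E.
Proof. by rewrite /mixture big1// => i _; rewrite measure0 mule0. Qed.

Let mixture_ge0 A : (0 <= mixture p P A)%E.
Proof.
by apply: sume_ge0 => i _; apply: mule_ge0 => //; rewrite lee_fin fdist_ge0.
Qed.

Let mixture_sigma_additive : semi_sigma_additive (mixture p P).
Proof.
move=> F mF tF mUF.
rewrite [X in X @ _ --> _](_ : _ = fun n =>
  (\sum_(i : I) (p i)%:E * \sum_(0 <= j < n) P i (F j))%E); last first.
  apply/funext => n; rewrite /mixture exchange_big/=.
  by apply: eq_bigr => i _; rewrite ge0_sume_distrr.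
apply: cvg_nnesum => [i _|i _].
  apply: nearW => n; apply: mule_ge0; first by rewrite lee_fin fdist_ge0.
  exact: sume_ge0.
by apply: cvgeZl => //; exact: measure_semi_sigma_additive.
Qed.

HB.instance Definition _ := isMeasure.Build _ _ _ (mixture p P)
  mixture0 mixture_ge0 mixture_sigma_additive.

Let mixture_setT : mixture p P setT = 1%E.
Proof.
rewrite /mixture.
under eq_bigr do rewrite probability_setT mule1.
by rewrite sumEFin fdist_sum1.
Qed.

HB.instance Definition _ :=
  Measure_isProbability.Build _ _ _ (mixture p P) mixture_setT.

End finite_mixtures.

Section densities.
Context d (Y : measurableType d) (R : realType)
  (mu : {measure set Y -> \bar R}).

(* Probability distributions on Y, given by a pointwise-defined density. *)
Record density := Density {
  density_fun :> Y -> R;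
  measurable_density : measurable_fun setT density_fun;
  density_ge0 : forall y, 0 <= density_fun y;
  density_int1 : (\int[mu]_y (density_fun y)%:E = 1)%E }.

Definition density_prob (p : density) (A : set Y) : \bar R :=
  (\int[mu]_(y in A) (p y)%:E)%E.

Variable p : density.

Let density_prob0 : density_prob p set0 = 0%E.
Proof. by rewrite /density_prob integral_set0. Qed.

Let density_prob_ge0 A : (0 <= density_prob p A)%E.
Proof. by apply: integral_ge0 => y _; rewrite lee_fin density_ge0. Qed.

Let density_prob_sigma_additive : semi_sigma_additive (density_prob p).
Proof.
apply: semi_sigma_additive_nng_induced.
  by apply/measurable_EFinP; exact: measurable_density.
by move=> y; rewrite lee_fin density_ge0.
Qed.

HB.instance Definition _ := isMeasure.Build _ _ _ (density_prob p)
  density_prob0 density_prob_ge0 density_prob_sigma_additive.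

Let density_prob_setT : density_prob p setT = 1%E.
Proof. exact: density_int1. Qed.

HB.instance Definition _ :=
  Measure_isProbability.Build _ _ _ (density_prob p) density_prob_setT.

End densities.

Section bind.
Context d d' (T : measurableType d) (U : measurableType d') (R : realType).

(* Law of the output of the randomized map K on an input of law P. *)
Definition pbind (P : probability T R) (K : R.-pker T ~> U) (A : set U) : \bar R :=
  (\int[P]_t K t A)%E.

Variables (P : probability T R) (K : R.-pker T ~> U).

Let pbind0 : pbind P K set0 = 0%E.
Proof.
by rewrite /pbind (eq_integral (cst 0%E)) ?integral0// => y _; rewrite measure0.
Qed.

Let pbind_ge0 A : (0 <= pbind P K A)%E.
Proof. exact: integral_ge0. Qed.

Let pbind_sigma_additive : semi_sigma_additive (pbind P K).
Proof.
move=> F mF tF mUF; rewrite [X in _ --> X](_ : _ =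
  \int[P]_y (\sum_(n <oo) K y (F n)))%E; last first.
  apply: eq_integral => V _.
  by apply/esym/cvg_lim => //; exact/measure_semi_sigma_additive.
apply/cvg_closeP; split.
  by apply: is_cvg_nneseries => n _ _; exact: integral_ge0.
rewrite closeE// integral_nneseries// => n.
exact: measurable_kernel.
Qed.

HB.instance Definition _ := isMeasure.Build _ _ _ (pbind P K)
  pbind0 pbind_ge0 pbind_sigma_additive.

Let pbind_setT : pbind P K setT = 1%E.
Proof.
transitivity (\int[P]_t (cst 1 t))%E.
  by apply: eq_integral => t _; exact: prob_kernel.
by rewrite integral_cst//= mul1e; exact: probability_setT.
Qed.

HB.instance Definition _ :=
  Measure_isProbability.Build _ _ _ (pbind P K) pbind_setT.

End bind.

Section nat_kernel.
Context d (U : measurableType d) (R : realType) (P : nat -> probability U R).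

Definition knat (m : nat) : {measure set U -> \bar R} := P m.

Let measurable_knat A : measurable A -> measurable_fun setT (knat ^~ A).
Proof. by []. Qed.

HB.instance Definition _ := isKernel.Build _ _ _ _ _ knat measurable_knat.

Let knat_prob m : knat m setT = 1%E.
Proof. exact: probability_setT. Qed.

HB.instance Definition _ := Kernel_isProbability.Build _ _ _ _ _ knat knat_prob.

End nat_kernel.

Section independent_samples.
Context d (T : measurableType d) (R : realType).

Definition tuple_cons n (xt : T * n.-tuple T) : n.+1.-tuple T :=
  [the n.+1.-tuple T of xt.1 :: xt.2].

Let measurable_tuple_cons n : measurable_fun setT (@tuple_cons n).
Proof. exact: measurable_cons. Qed.

HB.instance Definition _ n := isMeasurableFun.Build _ _ _ _ (@tuple_cons n)
  (@measurable_tuple_cons n).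

Fixpoint independent n : ('I_n -> probability T R) -> probability (n.-tuple T) R :=
  match n with
  | 0 => fun _ => \d_([tuple] : 0.-tuple T)
  | n'.+1 => fun P =>
      distribution (P ord0 \x independent (fun i => P (lift ord0 i)))%E
        (@tuple_cons n')
  end.

(* n+1 independent samples, the first one from P and the other n from Q. *)
Definition one_and_rest n (P Q : probability T R) : probability (n.+1.-tuple T) R :=
  independent (fun i : 'I_n.+1 => if i == ord0 then P else Q).

Lemma independentE n (P : 'I_n -> probability T R) (A : 'I_n -> set T) :
  (forall i, measurable (A i)) ->
  independent P [set t | forall i, A i (tnth t i)] = (\prod_(i < n) P i (A i))%E.
Proof.
elim: n P A => [|n IHn] P A mA.
  by rewrite big_ord0 /= diracE mem_set// => -[].
have mAn m (B : 'I_m -> set T) : (forall i, measurable (B i)) ->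
    measurable [set t : m.-tuple T | forall i, B i (tnth t i)].
  move=> mB; rewrite (_ : [set _ | _] =
      \bigcap_(i in [set: 'I_m]) ((@tnth m T ^~ i) @^-1` B i)); last first.
    by apply/seteqP; split=> t /=; [move=> Bt i _ | move=> Bt i]; exact: Bt.
  apply: fin_bigcap_measurable => // i _.
  by rewrite -[X in measurable X]setTI; exact: measurable_tnth.
rewrite big_ord_recl -IHn//= /distribution /pushforward/=.
rewrite (_ : _ @^-1` _ = A ord0 `*` [set t : n.-tuple T | forall i, A (lift ord0 i) (tnth t i)]).
  rewrite product_measure1E//; exact: (mAn _ (fun i => A (lift ord0 i))).
apply/seteqP; split=> [[x t] /= At|[x t] [/= Ax At] i].
  split; first exact: (At ord0).
  by move=> i; have := At (lift ord0 i); rewrite /tuple_cons tnthS.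
by case: (unliftP ord0 i) => [j|] ->; rewrite /tuple_cons ?tnthS.
Qed.

End independent_samples.

Section hockey_stick.
Local Open Scope charge_scope.
Context d (T : measurableType d) (R : realType).

Section common_reference.
Variables P Q : probability T R.

Definition common_ref : set T -> \bar R := measure_add P Q.

HB.instance Definition _ := Measure.on common_ref.

Let common_ref_finite : fin_num_fun common_ref.
Proof.
move=> A mA; rewrite /common_ref measure_addE.
by rewrite fin_numD !fin_num_measure.
Qed.

HB.instance Definition _ := Measure_isFinite.Build _ _ _ common_ref
  common_ref_finite.

End common_reference.

(* The densities are taken with respect to the common reference measure P + Q;
   by hockey_stickE, any other sigma-finite reference gives the same value. *)
Definition hockey_stick (alpha : R) (P Q : probability T R) : \bar R :=
  let p := 'd (charge_of_finite_measure P) '/d (common_ref P Q) in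
  let q := 'd (charge_of_finite_measure Q) '/d (common_ref P Q) in
  (\int[common_ref P Q]_x maxe 0 (p x - alpha%:E * q x))%E.

Lemma hockey_stickE (nu : {sigma_finite_measure set T -> \bar R}) (alpha : R)
    (P Q : probability T R) (p q : T -> R) :
  measurable_fun setT p -> measurable_fun setT q ->
  (forall x, 0 <= p x) -> (forall x, 0 <= q x) ->
  (forall A, measurable A -> P A = \int[nu]_(x in A) (p x)%:E)%E ->
  (forall A, measurable A -> Q A = \int[nu]_(x in A) (q x)%:E)%E ->
  (hockey_stick alpha P Q =
     \int[nu]_x (Num.max 0 (p x - alpha * q x))%:E)%E.
Proof.
move=> mp mq p0 q0 Pp Qq.
pose s := common_ref P Q.
have sE A : s A = (P A + Q A)%E by rewrite /s /common_ref measure_addE.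
have Ps : P `<< s.
  apply/null_content_dominatesP => A mA sA0; apply/eqP.
  by rewrite -measure_le0 -[leRHS](sA0 : s A = 0%E) sE leeDl.
have Qs : Q `<< s.
  apply/null_content_dominatesP => A mA sA0; apply/eqP.
  by rewrite -measure_le0 -[leRHS](sA0 : s A = 0%E) sE leeDr.
have mE (g : T -> R) : measurable_fun setT g -> measurable_fun setT (EFin \o g).
  by move=> mg; exact/measurable_EFinP.
have dens0 (M : probability T R) (g : T -> R) : measurable_fun setT g ->
    (forall A, measurable A -> M A = \int[nu]_(x in A) (g x)%:E)%E -> M `<< nu.
  move=> mg Mg; apply/null_content_dominatesP => A mA A0.
  by rewrite Mg// null_set_integral//; exact/measurable_funTS/mE.
have Pnu := dens0 _ _ mp Pp.
have Qnu := dens0 _ _ mq Qq.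
have snu : s `<< nu.
  apply/null_content_dominatesP => A mA A0; rewrite [LHS]sE.
  have /null_content_dominatesP -> // := Pnu.
  by have /null_content_dominatesP -> // := Qnu; rewrite adde0.
have int1 (M : probability T R) (g : T -> R) : measurable_fun setT g ->
    (forall x, 0 <= g x) ->
    (forall A, measurable A -> M A = \int[nu]_(x in A) (g x)%:E)%E ->
    nu.-integrable setT (EFin \o g).
  move=> mg g0 Mg; apply/integrableP; split; first exact: mE.
  under eq_integral do rewrite /= ger0_norm//.
  by rewrite -Mg// probability_setT ltry.
have ip := int1 _ _ mp p0 Pp.
have iq := int1 _ _ mq q0 Qq.
pose h := 'd (charge_of_finite_measure s) '/d nu.
pose f := 'd (charge_of_finite_measure P) '/d s.
pose g := 'd (charge_of_finite_measure Q) '/d s.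
have mh : measurable_fun setT h.
  exact: measurable_int (Radon_Nikodym_integrable _).
have mf : measurable_fun setT f.
  exact: measurable_int (Radon_Nikodym_integrable _).
have mg : measurable_fun setT g.
  exact: measurable_int (Radon_Nikodym_integrable _).
have hE : ae_eq nu setT (fun x => (p x + q x)%:E) h.
  apply: integral_ae_eq => //.
    by under eq_fun do rewrite EFinD; exact: integrableD.
  move=> E _ mE'; rewrite -Radon_Nikodym_integral//.
  transitivity (P E + Q E)%E; last exact/esym/sE.
  rewrite Pp// Qq//.
  under eq_integral do rewrite EFinD.
  by rewrite ge0_integralD// => *; rewrite ?lee_fin//; exact/measurable_funTS/mE.
have chain (M : probability T R) (u : T -> R) : measurable_fun setT u ->
    nu.-integrable setT (EFin \o u) -> M `<< s ->
    (forall A, measurable A -> M A = \int[nu]_(x in A) (u x)%:E)%E ->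
    ae_eq nu setT (EFin \o u) ('d (charge_of_finite_measure M) '/d s \* h)%E.
  move=> mu iu Ms Mu.
  have Mnu := dens0 _ _ mu Mu.
  apply: (ae_eq_trans _ (Radon_Nikodym_chain_rule (nu := charge_of_finite_measure M) Ms snu)).
  apply: integral_ae_eq => //.
  by move=> E _ mE'; rewrite -Radon_Nikodym_integral//; exact/esym/Mu.
have fE := chain _ _ mp ip Ps Pp.
have gE := chain _ _ mq iq Qs Qq.
have is_ (M : probability T R) : M `<< s ->
  s.-integrable setT ('d (charge_of_finite_measure M) '/d s).
  by move=> Ms; exact: Radon_Nikodym_integrable.
have imax : s.-integrable setT (fun x => maxe 0 (f x - alpha%:E * g x))%E.
  pose w := (fun x => f x - alpha%:E * g x)%E.
  rewrite (_ : (fun _ => _) = w^\+%E); last by apply/funext => x; rewrite funeposE maxC.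
  apply: integrable_funepos => //; apply: integrableB => //; first exact: is_.
  by apply: integrableZl => //; exact: is_.
transitivity (\int[nu]_x (maxe 0 (f x - alpha%:E * g x) * h x))%E.
  by rewrite (Radon_Nikodym_change_of_variables snu measurableT imax).
apply: ae_eq_integral => //.
- apply: emeasurable_funM => //; exact: measurable_int imax.
- apply: mE; apply: measurable_maxr => //; apply: measurable_funB => //.
  exact: measurable_funM.
move: hE fE gE; apply: filterS3 => x /= /(_ I) hE /(_ I) fE /(_ I) gE _.
have [fx gx] : f x \is a fin_num /\ g x \is a fin_num.
  by split; exact: Radon_Nikodym_fin_num.
move: fE gE; rewrite -/f -/g -hE -(fineK fx) -(fineK gx) => -[fE] [gE].
rewrite -!EFinM -EFinB -EFin_max -EFinM; congr (_%:E).
rewrite maxr_pMl ?addr_ge0// mul0r; congr Num.max.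
by rewrite mulrBl -mulrA -fE -gE.
Qed.

End hockey_stick.

Section shuffle_model.
Context d (Y : measurableType d) (R : realType) (n : nat).

Definition permute (s : {perm 'I_n}) (t : n.-tuple Y) : n.-tuple Y :=
  [tuple tnth t (s i) | i < n].

Let measurable_permute s : measurable_fun setT (permute s).
Proof.
apply/measurable_fun_tnthP => i; rewrite (_ : _ \o _ = @tnth n Y ^~ (s i)).
  exact: measurable_tnth.
by apply/funext => t /=; rewrite tnth_mktuple.
Qed.

HB.instance Definition _ s := isMeasurableFun.Build _ _ _ _ (permute s)
  (measurable_permute s).

Definition shuffle (P : probability (n.-tuple Y) R) : probability (n.-tuple Y) R :=
  mixture (fdist_uniform R (1%g : {perm 'I_n})) (fun s => distribution P (permute s)).

End shuffle_model.

Section protocol.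
Context d (Y : measurableType d) (R : realType)
  (mu : {measure set Y -> \bar R}) (X : Type) (r : X -> density mu).

Definition shuffled n (x : n.-tuple X) : probability (n.-tuple Y) R :=
  shuffle (independent (fun i => density_prob (r (tnth x i)))).

Record clone_decomposition (x0 x1 : X) (k : nat) := CloneDecomposition {
  cd_Q : 'I_k -> density mu;
  cd_a : 'I_k -> R;
  cd_b : 'I_k -> R;
  cd_c : 'I_k -> R;
  cd_beta : R;
  cd_LO : X -> density mu;
  cd_k_gt0 : (0 < k)%N;
  cd_a_ge0 : forall j, 0 <= cd_a j;
  cd_b_ge0 : forall j, 0 <= cd_b j;
  cd_c_ge0 : forall j, 0 <= cd_c j;
  cd_beta_ge0 : 0 <= cd_beta;
  cd_a_sum1 : \sum_j cd_a j = 1;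
  cd_b_sum1 : \sum_j cd_b j = 1;
  cd_c_sum1 : cd_beta + \sum_j cd_c j = 1;
  cd_x0E : forall y, r x0 y = \sum_j cd_a j * cd_Q j y;
  cd_x1E : forall y, r x1 y = \sum_j cd_b j * cd_Q j y;
  cd_xE : forall x y, r x y = \sum_j cd_c j * cd_Q j y + cd_beta * cd_LO x y }.

Definition blanket_inf (y : Y) : R := inf [set r x y | x in setT].

Definition blanket_gamma : R := \int[mu]_y blanket_inf y.

(* omega is unconstrained when gamma = 0, where only the size 0 is drawn below. *)
Definition is_blanket (omega : density mu) : Prop :=
  blanket_gamma != 0 -> forall y, omega y = blanket_inf y / blanket_gamma.

Section blanket_law.
Variable m : nat.

Definition sized_multiset (t : m.+1.-tuple Y) : nat * mset_of Y :=
  (m, seq_mset t : mset_of Y).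

Let measurable_sized_multiset : measurable_fun setT sized_multiset.
Proof.
apply: measurable_fun_pair => //.
by move=> _ A mA; rewrite setTI; exact: mA.
Qed.

HB.instance Definition _ := isMeasurableFun.Build _ _ _ _ sized_multiset
  measurable_sized_multiset.

End blanket_law.

(* Law of (|b|, Y_{|b|}) for n+1 users, xa being the input of the first one:
   |b| ~ Bin(n, gamma), and Y_m has m samples from omega besides that of xa. *)
Definition blanket_pair n (omega : density mu) (xa : X) :
    probability (nat * mset_of Y)%type R :=
  pbind (binomial_prob n blanket_gamma)
    (knat (fun m => distribution
      (one_and_rest m (density_prob (r xa)) (density_prob omega))
      (@sized_multiset m))).

End protocol.

Section histogram.
Context (R : realType) (k n : nat).

Definition histogram (t : n.-tuple 'I_k.+1) : k.+1.-tuple nat :=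
  [tuple count_mem j t | j < k.+1].

Let measurable_histogram : measurable_fun setT histogram.
Proof.
move=> _ A _; rewrite setTI.
rewrite -[X in measurable X]image_id -bigcup_imset1.
apply: fin_bigcup_measurable => [|t _]; first exact: finite_finset.
rewrite (_ : [set t] =
    \bigcap_(i in [set: 'I_n]) ((@tnth n 'I_k.+1 ^~ i) @^-1` [set tnth t i])).
  apply: fin_bigcap_measurable => // i _.
  by rewrite -[X in measurable X]setTI; exact: measurable_tnth.
apply/seteqP; split=> [_ -> //|u /= ut].
by apply: eq_from_tnth => i; exact: ut.
Qed.

HB.instance Definition _ := isMeasurableFun.Build _ _ _ _ histogram
  measurable_histogram.

End histogram.

Section reduction_pair.
Context (R : realType) (k : nat).

Definition extend_weights (w : 'I_k -> R) (v : R) (j : 'I_k.+1) : R :=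
  if unlift ord_max j is Some i then w i else v.

Variables (w : 'I_k -> R) (v : R).
Hypotheses (w_ge0 : forall j, 0 <= w j) (v_ge0 : 0 <= v).
Hypothesis wv1 : v + \sum_j w j = 1.

Lemma extend_weights_ge0 j : 0 <= extend_weights w v j.
Proof. by rewrite /extend_weights; case: unliftP. Qed.

Lemma extend_weights_sum1 : \sum_j extend_weights w v j = 1.
Proof.
rewrite (bigD1_ord ord_max)//= /extend_weights unlift_none.
by under eq_bigr do rewrite liftK.
Qed.

Definition extend_fdist : fdist R 'I_k.+1 :=
  FDist extend_weights_ge0 extend_weights_sum1.

Definition label_prob (p : fdist R 'I_k.+1) : probability 'I_k.+1 R :=
  mixture p (fun j => \d_j).

End reduction_pair.

Section clone_pair.
Context d (Y : measurableType d) (R : realType)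
  (mu : {measure set Y -> \bar R}) (X : Type) (r : X -> density mu)
  (x0 x1 : X) (k : nat) (D : clone_decomposition r x0 x1 k).

Lemma add0_sum1 (w : 'I_k -> R) : \sum_j w j = 1 -> 0 + \sum_j w j = 1.
Proof. by rewrite add0r. Qed.

(* The labels 1, ..., k+1 are the elements of 'I_k.+1, with ord_max for k+1. *)
Definition A0 : probability 'I_k.+1 R := label_prob
  (extend_fdist (cd_a_ge0 D) (lexx 0) (add0_sum1 (cd_a_sum1 D))).

Definition A1 : probability 'I_k.+1 R := label_prob
  (extend_fdist (cd_b_ge0 D) (lexx 0) (add0_sum1 (cd_b_sum1 D))).

Definition A2 : probability 'I_k.+1 R := label_prob
  (extend_fdist (cd_c_ge0 D) (cd_beta_ge0 D) (cd_c_sum1 D)).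

(* Law of the histogram for n+1 users, A being the label law of the first one. *)
Definition clone_pair n (A : probability 'I_k.+1 R) : probability (k.+1.-tuple nat) R :=
  distribution (one_and_rest n A A2) (@histogram k n.+1).

End clone_pair.

(* Main.v *)
Require Import Defs.
From HB Require Import structures.
From mathcomp Require Import all_boot all_order all_algebra all_fingroup finmap multiset.
From mathcomp Require Import all_classical all_reals all_analysis measurable_realfun.

(* Post-processing the clone histogram: gamma * omega dominates the density
   sum_j c_j Q_j, so gamma * omega = sum_j c_j Q_j + (gamma - C) e with
   C = sum_j c_j and e a density. Replacing every label j <= k by a sample of
   Q_j, and label k+1 by a sample of e with probability (gamma - C) / beta and by
   nothing otherwise, turns a label of law A_2 into a sample of omega with
   probability gamma and into nothing otherwise, and a label of law A_a into a
   sample of R(x_1^a). Conversely R(x) = gamma * omega + (1 - gamma) L_x, so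
   M_S(X_a) is recovered from the blanket pair by adding samples of the L_{x_i}
   for a uniformly random set of n - 1 - |b| users and shuffling.
   Both arguments are carried out on the operators F |-> E F(S + sample) acting on
   measurable functions of multisets: these commute by Tonelli's theorem, so that
   products of them expand binomially. The hockey-stick divergence decreases
   because D(P || Q) is the supremum over tests 0 <= phi <= 1 of
   \int phi dP - alpha \int phi dQ. *)

Set Implicit Arguments.
Unset Strict Implicit.
Unset Printing Implicit Defensive.

Import Order.TTheory GRing.Theory Num.Theory.
Import numFieldNormedType.Exports.

Local Open Scope classical_set_scope.
Local Open Scope ring_scope.

(** * Hockey-stick divergence and tests *)

Section hockey_stick_testing.
Local Open Scope ereal_scope.
Local Open Scope charge_scope.
Context d (T : measurableType d) (R : realType) (alpha : R) (P Q : probability T R).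

Let s := common_ref P Q.
Let p := 'd (charge_of_finite_measure P) '/d s.
Let q := 'd (charge_of_finite_measure Q) '/d s.
Let w (x : T) : \bar R := p x - alpha%:E * q x.

Let sE A : s A = P A + Q A.
Proof. by rewrite /s /common_ref measure_addE. Qed.

Let Ps : P `<< s.
Proof.
apply/null_content_dominatesP => A mA sA0; apply/eqP.
by rewrite -measure_le0 -[leRHS](sA0 : s A = 0%E) sE leeDl.
Qed.

Let Qs : Q `<< s.
Proof.
apply/null_content_dominatesP => A mA sA0; apply/eqP.
by rewrite -measure_le0 -[leRHS](sA0 : s A = 0%E) sE leeDr.
Qed.

Let ip : s.-integrable setT p. Proof. exact: Radon_Nikodym_integrable. Qed.
Let iq : s.-integrable setT q. Proof. exact: Radon_Nikodym_integrable. Qed.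

Let iw : s.-integrable setT w.
Proof. by apply: integrableB => //; exact: integrableZl. Qed.

Let mw : measurable_fun setT w. Proof. exact: measurable_int iw. Qed.

Let integral_w A : measurable A ->
  \int[s]_(x in A) w x = P A - alpha%:E * Q A.
Proof.
move=> mA; rewrite /w integralB//; last 2 first.
- exact: integrableS ip.
- by apply: integrableZl => //; exact: integrableS iq.
rewrite integralZl//; last exact: integrableS iq.
by rewrite -!Radon_Nikodym_integral.
Qed.

Let hockeyE : hockey_stick alpha P Q = \int[s]_x maxe 0 (w x).
Proof. by []. Qed.

(** The supremum over tests is attained at the indicator of the set where the signed density [w] is
    nonnegative. *)
Lemma hockey_stick_event : exists A, measurable A /\
  hockey_stick alpha P Q = P A - alpha%:E * Q A.
Proof.
exists [set x | 0 <= w x].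
have mA : measurable [set x | 0 <= w x].
  rewrite -[X in measurable X]setTI.
  exact: emeasurable_fun_c_infty.
split=> //; rewrite -integral_w// hockeyE [RHS]integral_mkcond.
apply: eq_integral => x _; rewrite patchE.
case: ifPn => [/set_mem/= /max_idPr ->//|].
by rewrite notin_setE/= => /negP; rewrite -ltNge => /ltW /max_idPl.
Qed.

(** Both integrals are rewritten against [s]; the left side becomes the integral of [phi * w], which
    is pointwise at most [max 0 w]. *)
Lemma le_hockey_stick (phi : T -> \bar R) :
  measurable_fun setT phi -> (forall x, 0 <= phi x <= 1) ->
  \int[P]_x phi x - alpha%:E * \int[Q]_x phi x <= hockey_stick alpha P Q.
Proof.
move=> mphi phi01.
have int (m : probability T R) : m.-integrable setT phi.
  apply: (le_integrable measurableT mphi _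
    (finite_measure_integrable_cst m 1%R measurableT)) => x _.
  have /andP[phi0 phi1] := phi01 x.
  by rewrite gee0_abs//= normr1.
have is_ (g : T -> \bar R) : s.-integrable setT g ->
    s.-integrable setT (phi \* g).
  move=> ig; have mg := measurable_int _ ig.
  apply: (le_integrable measurableT _ _ ig).
    exact: emeasurable_funM.
  move=> x _; have /andP[phi0 phi1] := phi01 x.
  by rewrite abseM (gee0_abs phi0) gee_pMl// ge0_fin_numE// (le_lt_trans phi1)// ltry.
rewrite -(Radon_Nikodym_change_of_variables Ps measurableT (int P)).
rewrite -(Radon_Nikodym_change_of_variables Qs measurableT (int Q)).
rewrite -integralZl//; last exact: is_.
rewrite -integralB//; [|exact: is_|by apply: integrableZl => //; exact: is_].
rewrite hockeyE.
have imax : s.-integrable setT (fun x => maxe 0 (w x)).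
  rewrite (_ : (fun _ => _) = w^\+); first exact: integrable_funepos.
  by apply/funext => x; rewrite funeposE maxC.
apply: le_integral => //.
  by apply: integrableB => //; [exact: is_|apply: integrableZl => //; exact: is_].
move=> x _.
have /andP[phi0 phi1] := phi01 x.
have fphi : phi x \is a fin_num.
  by rewrite ge0_fin_numE//; apply: le_lt_trans phi1 _; rewrite ltry.
have fp : p x \is a fin_num by exact: Radon_Nikodym_fin_num.
have fq : q x \is a fin_num by exact: Radon_Nikodym_fin_num.
rewrite muleCA -muleBr//; last by rewrite fin_num_adde_defr// fin_numM.
have [w0|w0] := leP 0 (w x).
  rewrite gee_pMl//.
by rewrite mule_ge0_le0// ltW.
Qed.

End hockey_stick_testing.

(** The optimal event for [P'], [Q'] pulls back to a test for [P], [Q]. A test is asked for each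
    event separately, so no kernel has to be exhibited. *)
Lemma hockey_stick_data_processing (R : realType) d (T : measurableType d)
    d' (T' : measurableType d') (alpha : R)
    (P Q : probability T R) (P' Q' : probability T' R) :
  (forall A, measurable A -> exists phi : T -> \bar R,
    [/\ measurable_fun setT phi, forall x, (0 <= phi x <= 1)%E,
        (P' A = \int[P]_x phi x)%E & (Q' A = \int[Q]_x phi x)%E]) ->
  (hockey_stick alpha P' Q' <= hockey_stick alpha P Q)%E.
Proof.
move=> H; have [A [mA ->]] := hockey_stick_event alpha P' Q'.
have [phi [mphi phi01 -> ->]] := H _ mA.
exact: le_hockey_stick.
Qed.

(** * Integration against finite mixtures *)

Section ge0_sum.
Local Open Scope ereal_scope.
Context d (T : measurableType d) (R : realType).

Lemma integral_mixture (N : nat) (c : 'I_N -> R) (m : 'I_N -> {measure set T -> \bar R})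
    (M : {measure set T -> \bar R}) (f : T -> \bar R) :
  (forall i, (0 <= c i)%R) ->
  (forall A, measurable A -> M A = \sum_i (c i)%:E * m i A) ->
  measurable_fun setT f -> (forall x, 0 <= f x) ->
  \int[M]_x f x = \sum_i (c i)%:E * \int[m i]_x f x.
Proof.
move=> c0 ME mf f0.
(* Finite sums of measures are indexed by [nat]: the family is extended by the zero measure from [N]
   on. *)
pose m' (j : nat) : {measure set T -> \bar R} :=
  if insub j is Some i then mscale (NngNum (c0 i)) (m i) else mzero.
rewrite (eq_measure_integral (msum m' N)); last first.
  move=> A mA _; rewrite ME//= /msum; apply: eq_bigr => i _.
  by rewrite /m' valK.
rewrite ge0_integral_measure_sum//; apply: eq_bigr => i _.
by rewrite /m' valK ge0_integral_mscale.
Qed.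

Lemma integral_mixture2 (a b : R) (m1 m2 M : {measure set T -> \bar R})
    (f : T -> \bar R) :
  (0 <= a)%R -> (0 <= b)%R ->
  (forall A, measurable A -> M A = a%:E * m1 A + b%:E * m2 A) ->
  measurable_fun setT f -> (forall x, 0 <= f x) ->
  \int[M]_x f x = a%:E * \int[m1]_x f x + b%:E * \int[m2]_x f x.
Proof.
move=> a0 b0 ME mf f0.
rewrite (@integral_mixture 2 (fun i => if i == ord0 then a else b)
  (fun i => if i == ord0 then m1 else m2))//.
- by rewrite big_ord_recl big_ord1.
- by move=> i; case: ifP.
- by move=> A mA; rewrite ME// big_ord_recl big_ord1.
Qed.

End ge0_sum.

(** * Adding random samples to a multiset *)

Section multiset_functions.
Local Open Scope ereal_scope.
Context d (Y : measurableType d) (R : realType).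
Implicit Types (F : mset_of Y -> \bar R) (S : mset_of Y).

Definition mset_add (y : Y) S : mset_of Y := (y +` S)%mset.

Lemma seq_mset_cons (y : Y) (s : seq Y) :
  seq_mset (y :: s) = mset_add y (seq_mset s).
Proof. by apply/msetP => z; rewrite mset1DE !mset_seqE /= eq_sym. Qed.

Lemma seq_mset_nil : seq_mset ([::] : seq Y) = mset0.
Proof. by apply/msetP => z; rewrite mset_seqE mset0E. Qed.

Lemma mset_addC (x y : Y) S : mset_add x (mset_add y S) = mset_add y (mset_add x S).
Proof. exact: msetDCA. Qed.

(** The sigma-algebra on multisets is the final one for the maps [seq_mset], so measurability is
    tested on tuples of each length. *)
Lemma measurable_fun_msetP d' (U : measurableType d') (F : mset_of Y -> U) :
  measurable_fun setT F <->
  forall m, measurable_fun setT (fun t : m.-tuple Y => F (seq_mset t)).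
Proof.
split=> [mF m|mF] _ B mB.
  have := mF measurableT B mB; rewrite !setTI => mFB; exact: (mFB m).
rewrite setTI; change (mset_measurable (F @^-1` B)) => m.
by have := mF m measurableT B mB; rewrite setTI.
Qed.

(** Lists [S] in some order: a fixed multiset becomes the image of a tuple, to which the criterion
    on tuples applies. *)
Definition mset_enum S : seq Y := (S : {mset Y}%mset).

Lemma mset_enumK : cancel mset_enum (@seq_mset Y).
Proof. exact: seq_mset_id. Qed.

Section measurable_mset_add.
Context d' (U : measurableType d') (F : mset_of Y -> \bar R).
Hypothesis mF : measurable_fun setT F.

Lemma measurable_seq_mset m (g : U -> m.-tuple Y) :
  measurable_fun setT g -> measurable_fun setT (fun u => F (seq_mset (g u))).
Proof. exact: (measurableT_comp ((measurable_fun_msetP F).1 mF m)). Qed.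

Lemma measurable_mset_add_seq (f : U -> Y) m (g : U -> m.-tuple Y) :
  measurable_fun setT f -> measurable_fun setT g ->
  measurable_fun setT (fun u => F (mset_add (f u) (seq_mset (g u)))).
Proof.
move=> mf mg; under eq_fun do rewrite -seq_mset_cons.
by apply: measurable_seq_mset (measurable_cons mf mg).
Qed.

Lemma measurable_mset_add (f : U -> Y) S :
  measurable_fun setT f -> measurable_fun setT (fun u => F (mset_add (f u) S)).
Proof.
move=> mf; rewrite -(mset_enumK S).
exact: (measurable_mset_add_seq (g := cst (in_tuple (mset_enum S)))).
Qed.

Lemma measurable_mset_add2 (f g : U -> Y) S :
  measurable_fun setT f -> measurable_fun setT g ->
  measurable_fun setT (fun u => F (mset_add (f u) (mset_add (g u) S))).
Proof.
move=> mf mg; rewrite -(mset_enumK S); under eq_fun do rewrite -seq_mset_cons.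
apply: (measurable_mset_add_seq
  (g := fun u => [the _.-tuple Y of g u :: in_tuple (mset_enum S)])) => //.
exact: (measurable_cons (g := cst (in_tuple (mset_enum S)))).
Qed.

End measurable_mset_add.

(* The expectation of F after adding, with probability theta, one sample from P. *)
Definition thin (theta : R) (P : probability Y R) F S : \bar R :=
  theta%:E * \int[P]_y F (mset_add y S) + (1 - theta)%:E * F S.

Definition nnmeasurable F := measurable_fun setT F /\ forall S, 0 <= F S.

Section thin_theory.
Variables (theta : R) (P : probability Y R).
Hypothesis theta01 : (0 <= theta <= 1)%R.

Let theta0 : 0 <= theta%:E. Proof. by rewrite lee_fin; case/andP: theta01. Qed.
Let theta1 : 0 <= (1 - theta)%:E.
Proof. by rewrite lee_fin subr_ge0; case/andP: theta01. Qed.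

Let int_ge0 F S : nnmeasurable F -> 0 <= \int[P]_y F (mset_add y S).
Proof. by move=> [_ F0]; exact: integral_ge0. Qed.

(** On [m]-tuples the integral is a partial integral of a function jointly measurable in the tuple
    and the added sample, so Tonelli applies. *)
Lemma nnmeasurable_thin F : nnmeasurable F -> nnmeasurable (thin theta P F).
Proof.
move=> [mF F0]; split; last first.
  by move=> S; rewrite adde_ge0// mule_ge0//; exact: integral_ge0.
apply: emeasurable_funD; apply: measurable_funeM => //.
apply/measurable_fun_msetP => m.
apply: (measurable_fun_fubini_tonelli_F (m2 := P)
  (fun z : m.-tuple Y * Y => F (mset_add z.2 (seq_mset z.1)))) => //.
exact: measurable_mset_add_seq.
Qed.

Lemma thin_sum I (s : seq I) (c : I -> \bar R) (F : I -> mset_of Y -> \bar R) S :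
  (forall i, 0 <= c i) -> (forall i, nnmeasurable (F i)) ->
  thin theta P (fun S => \sum_(i <- s) c i * F i S) S =
  \sum_(i <- s) c i * thin theta P (F i) S.
Proof.
move=> c0 mF; rewrite /thin.
have cF i S' : 0 <= c i * F i S' by rewrite mule_ge0//; case: (mF i).
rewrite ge0_integral_sum//; last first.
  by move=> i; apply: measurable_funeM; apply: measurable_mset_add => //; case: (mF i).
rewrite ge0_sume_distrr; last by move=> i _; exact: integral_ge0.
rewrite ge0_sume_distrr// -big_split/=; apply: eq_bigr => i _.
rewrite ge0_integralZl//.
- rewrite [in RHS](@ge0_muleDr _ _ (theta%:E * _)); last 2 first.
  - by rewrite mule_ge0//; exact: int_ge0.
  - by rewrite mule_ge0//; case: (mF i).
  by rewrite !(muleCA _ (c i)).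
- by apply: measurable_mset_add => //; case: (mF i).
- by move=> y _; case: (mF i).
Qed.

(** Monotone convergence for series; it later makes [filling] countably additive. *)
Lemma thin_nneseries (F : nat -> mset_of Y -> \bar R) S :
  (forall i, nnmeasurable (F i)) ->
  thin theta P (fun S => \sum_(i <oo) F i S) S = \sum_(i <oo) thin theta P (F i) S.
Proof.
move=> mF; rewrite /thin integral_nneseries//; last 2 first.
- by move=> i; apply: measurable_mset_add => //; case: (mF i).
- by move=> i y _; case: (mF i).
rewrite (@nneseriesD _ (fun i => theta%:E * \int[P]_y F i (mset_add y S))
  (fun i => (1 - theta)%:E * F i S))//; last 2 first.
- by move=> i _ _; rewrite mule_ge0//; exact: int_ge0.
- by move=> i _ _; rewrite mule_ge0//; case: (mF i).
rewrite (nneseriesZl theta) ?(nneseriesZl (1 - theta))//.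
- by move=> i _; case: (mF i).
- by move=> i _; exact: int_ge0.
Qed.

Lemma thin_cst (c : R) S : thin theta P (cst c%:E) S = c%:E.
Proof.
rewrite /thin integral_cst//= probability_setT mule1 -!EFinM -EFinD; congr EFin.
by rewrite -mulrDl addrC subrK mul1r.
Qed.

Lemma le_thin F G S : nnmeasurable F -> nnmeasurable G -> (forall S, F S <= G S) ->
  thin theta P F S <= thin theta P G S.
Proof.
move=> [mF F0] [mG G0] FG; apply: leeD; apply: lee_wpmul2l => //.
by apply: ge0_le_integral => // *; exact: measurable_mset_add.
Qed.

End thin_theory.

Lemma eq_thin (theta : R) (P : probability Y R) F G S :
  (forall S, F S = G S) -> thin theta P F S = thin theta P G S.
Proof. by move=> /funext ->. Qed.

Lemma thin1E (P : probability Y R) F S :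
  thin 1 P F S = \int[P]_y F (mset_add y S).
Proof. by rewrite /thin subrr mul0e adde0 mul1e. Qed.

Lemma thin0E (P : probability Y R) F S : thin 0 P F S = F S.
Proof. by rewrite /thin mul0e add0e subr0 mul1e. Qed.

(** Four terms, according to which of the two samples are kept. *)
Let thin_thin (a b : R) (P Q : probability Y R) F S :
  (0 <= a <= 1)%R -> (0 <= b <= 1)%R -> nnmeasurable F ->
  thin a P (thin b Q F) S =
  (a%:E * (b%:E * \int[P]_x \int[Q]_y F (mset_add y (mset_add x S)))
   + (1 - a)%:E * (b%:E * \int[Q]_y F (mset_add y S)))
  + (a%:E * ((1 - b)%:E * \int[P]_x F (mset_add x S))
   + (1 - a)%:E * ((1 - b)%:E * F S)).
Proof.
move=> a01 b01 mF; have [mF' F0] := mF.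
have [b0 b1] : 0 <= b%:E /\ 0 <= (1 - b)%:E.
  by rewrite !lee_fin subr_ge0; case/andP: b01.
have [a0 a1] : 0 <= a%:E /\ 0 <= (1 - a)%:E.
  by rewrite !lee_fin subr_ge0; case/andP: a01.
have mI : measurable_fun setT (fun x => \int[Q]_y F (mset_add y (mset_add x S))).
  apply: (measurable_fun_fubini_tonelli_F (m2 := Q)
    (fun z : Y * Y => F (mset_add z.2 (mset_add z.1 S)))) => //.
  exact: measurable_mset_add2.
have I0 x : 0 <= \int[Q]_y F (mset_add y x) by exact: integral_ge0.
rewrite {1}/thin /thin ge0_integralD//; last 4 first.
- by move=> x _; rewrite mule_ge0.
- exact: measurable_funeM.
- by move=> x _; rewrite mule_ge0.
- by apply: measurable_funeM; exact: measurable_mset_add.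
rewrite !ge0_integralZl//; last exact: measurable_mset_add.
have distr (u v x y z t : \bar R) : 0 <= x -> 0 <= y -> 0 <= z -> 0 <= t ->
    u * (x + y) + v * (z + t) = (u * x + v * z) + (u * y + v * t).
  by move=> *; rewrite !ge0_muleDr// addeACA.
by rewrite distr// mule_ge0//; apply: integral_ge0 => // *; exact: integral_ge0.
Qed.

(** After reordering the four terms, only the one where both samples are kept needs an argument:
    Tonelli and the commutativity of [mset_add]. *)
Lemma thinC (a b : R) (P Q : probability Y R) F S :
  (0 <= a <= 1)%R -> (0 <= b <= 1)%R -> nnmeasurable F ->
  thin a P (thin b Q F) S = thin b Q (thin a P F) S.
Proof.
move=> a01 b01 mF; rewrite !thin_thin// [RHS]addeACA.
congr (_ + _); congr (_ + _); rewrite muleCA//; congr (_ * (_ * _)).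
rewrite (fubini_tonelli (m1 := P) (m2 := Q)
  (fun z : Y * Y => F (mset_add z.2 (mset_add z.1 S)))).
- by apply: eq_integral => y _; apply: eq_integral => x _; rewrite mset_addC.
- by apply: measurable_mset_add2 => //; case: mF.
- by move=> z; case: mF.
Qed.

End multiset_functions.

Section thins.
Local Open Scope ereal_scope.
Context d (Y : measurableType d) (R : realType).
Implicit Types (F G : mset_of Y -> \bar R) (S : mset_of Y).

Section thins_theory.
Context (J : eqType) (theta : J -> R) (P : J -> probability Y R).
Implicit Type l : seq J.

(** The expectation of [F] after adding, for each [j] in [l] independently, a sample of [P j] kept
    with probability [theta j]. *)
Definition thins l F := foldr (fun j => thin (theta j) (P j)) F l.

Hypothesis theta01 : forall j, (0 <= theta j <= 1)%R.

Lemma nnmeasurable_thins l F : nnmeasurable F -> nnmeasurable (thins l F).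
Proof. by move=> mF; elim: l => //= j l; exact: nnmeasurable_thin. Qed.

Lemma eq_thins l F G S : (forall S, F S = G S) -> thins l F S = thins l G S.
Proof. by move=> /funext ->. Qed.

Lemma thins_sum I (s : seq I) (c : I -> \bar R) (F : I -> mset_of Y -> \bar R) l S :
  (forall i, 0 <= c i) -> (forall i, nnmeasurable (F i)) ->
  thins l (fun S => \sum_(i <- s) c i * F i S) S =
  \sum_(i <- s) c i * thins l (F i) S.
Proof.
move=> c0 mF; elim: l S => //= j l IHl S.
by rewrite (eq_thin _ _ _ IHl) thin_sum// => i; exact: nnmeasurable_thins.
Qed.

Lemma thins_nneseries (F : nat -> mset_of Y -> \bar R) l S :
  (forall i, nnmeasurable (F i)) ->
  thins l (fun S => \sum_(i <oo) F i S) S = \sum_(i <oo) thins l (F i) S.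
Proof.
move=> mF; elim: l S => //= j l IHl S.
by rewrite (eq_thin _ _ _ IHl) thin_nneseries// => i; exact: nnmeasurable_thins.
Qed.

Lemma thins_cst (c : R) l S : thins l (cst c%:E) S = c%:E.
Proof.
elim: l S => //= j l IHl S.
by rewrite (eq_thin _ _ _ IHl) thin_cst.
Qed.

Lemma thins_thin (a : R) (Q : probability Y R) l F S :
  (0 <= a <= 1)%R -> nnmeasurable F ->
  thins l (thin a Q F) S = thin a Q (thins l F) S.
Proof.
move=> a01 mF; elim: l S => //= j l IHl S.
by rewrite (eq_thin _ _ _ IHl) thinC//; exact: nnmeasurable_thins.
Qed.

(** By commutation the factor of [j] can be pulled to the front of [l']. Hence the product depends
    only on the multiset of labels, which is what a histogram records. *)
Lemma perm_thins l l' F : nnmeasurable F -> perm_eq l l' -> thins l F = thins l' F.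
Proof.
move=> mF; elim: l l' => [|j l IHl] l' jl.
  by move: jl; rewrite perm_sym => /perm_nilP ->.
have jl' : j \in l' by rewrite -(perm_mem jl) mem_head.
have : perm_eq l (rem j l').
  by rewrite -(perm_cons j) (perm_trans jl)// perm_to_rem.
move=> /IHl /= ->; rewrite {IHl jl}.
elim: l' jl' => //= i l' IHl'; rewrite inE eq_sym.
case: eqVneq => [->//|ij /= jl']; rewrite -IHl'//=.
by apply/funext => S; rewrite thinC//; exact: nnmeasurable_thins.
Qed.

Lemma thins_mset_add y l F S :
  thins l (fun S => F (mset_add y S)) S = thins l F (mset_add y S).
Proof.
elim: l S => //= j l IHl S; rewrite /thin IHl; congr (_ * _ + _).
by apply: eq_integral => z _; rewrite IHl mset_addC.
Qed.

End thins_theory.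

Lemma thins_map (I J : eqType) (f : I -> J) theta (P : J -> probability Y R) l F :
  thins theta P (map f l) F = thins (theta \o f) (P \o f) l F.
Proof. exact: foldr_map. Qed.

Lemma nnmeasurable_mset_add y F :
  nnmeasurable F -> nnmeasurable (fun S => F (mset_add y S)).
Proof.
move=> [mF F0]; split=> //; apply/measurable_fun_msetP => m.
exact: (measurable_mset_add_seq mF (f := cst y)).
Qed.

End thins.

(** * Expectations over independent samples and independent labels *)

Section independent_integral.
Local Open Scope ereal_scope.
Context d (T : measurableType d) (R : realType).

Lemma integral_independent0 (P : 'I_0 -> probability T R) (f : 0.-tuple T -> \bar R) :
  measurable_fun setT f -> \int[independent P]_t f t = f [tuple].
Proof. by move=> mf; rewrite integral_dirac//= diracT mul1e. Qed.

Lemma integral_independentS n (P : 'I_n.+1 -> probability T R)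
    (f : n.+1.-tuple T -> \bar R) :
  measurable_fun setT f -> (forall t, 0 <= f t) ->
  \int[independent P]_t f t =
  \int[P ord0]_x \int[independent (fun i => P (lift ord0 i))]_t
    f [the n.+1.-tuple T of x :: t].
Proof.
move=> mf f0; rewrite /= ge0_integral_distribution//.
rewrite (fubini_tonelli1 (m1 := P ord0)
  (m2 := independent (fun i => P (lift ord0 i))) (f \o @tuple_cons d T n))//.
  by apply: measurableT_comp => //; exact: measurable_cons.
by move=> z; exact: f0.
Qed.

End independent_integral.

(** Passes from laws on tuples to operators: each sample contributes an operator that always keeps
    it, and the product is evaluated at the empty multiset. *)
Lemma integral_seq_mset d (Y : measurableType d) (R : realType) n
    (P : 'I_n -> probability Y R) (F : mset_of Y -> \bar R) :
  nnmeasurable F ->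
  (\int[independent P]_t F (seq_mset t) = thins (fun=> 1%R) P (enum 'I_n) F mset0)%E.
Proof.
elim: n P F => [|n IHn] P F mF.
  rewrite integral_independent0 ?enum_ord0 /= ?seq_mset_nil//.
  by case: mF => /measurable_fun_msetP.
rewrite integral_independentS; last 2 first.
- by case: mF => /measurable_fun_msetP.
- by move=> t; case: mF.
rewrite enum_ordSl [RHS]/= thin1E; apply: eq_integral => y _.
under eq_integral do rewrite /= seq_mset_cons.
(* The first sample [y] is absorbed into the function, then [thins_mset_add] moves it to the
   starting multiset. *)
rewrite (IHn _ (fun S => F (mset_add y S))); last exact: nnmeasurable_mset_add.
by rewrite thins_mset_add (thins_map (lift ord0)).
Qed.

Section discrete_tuples.
Context d (T : measurableType d) (n : nat).
Hypotheses (mT : forall x : T, measurable [set x])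
  (cT : forall A : set (n.-tuple T), countable A).

(** Points are finite intersections of cylinders, and every set of tuples is a countable union of
    points. Functions of label tuples and of histograms are thus automatically measurable. *)
Lemma discrete_measurable_tuple (A : set (n.-tuple T)) : measurable A.
Proof.
apply: countable_measurable => // t.
rewrite (_ : [set t] =
    \bigcap_(i in [set: 'I_n]) ((@tnth n T ^~ i) @^-1` [set tnth t i])).
  apply: fin_bigcap_measurable => // i _.
  by rewrite -[X in measurable X]setTI; exact: measurable_tnth.
apply/seteqP; split=> [_ -> //|u /= ut].
by apply: eq_from_tnth => i; exact: ut.
Qed.

Lemma discrete_measurable_fun_tuple d' (U : measurableType d') (f : n.-tuple T -> U) :
  measurable_fun setT f.
Proof. by move=> _ B _; exact: discrete_measurable_tuple. Qed.

End discrete_tuples.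

Lemma measurable_fun_nat_tuple k d' (U : measurableType d') (f : k.-tuple nat -> U) :
  measurable_fun setT f.
Proof. by apply: discrete_measurable_fun_tuple => // A; exact: countableP. Qed.

Lemma measurable_fun_label_tuple k n d' (U : measurableType d')
  (f : n.-tuple 'I_k.+1 -> U) : measurable_fun setT f.
Proof. by apply: discrete_measurable_fun_tuple => // A; exact: countableP. Qed.

Section label_integral.
Local Open Scope ereal_scope.
Context d (Y : measurableType d) (R : realType) (k : nat).
Variables (theta : 'I_k.+1 -> R) (Q : 'I_k.+1 -> probability Y R).
Hypothesis theta01 : forall j, (0 <= theta j <= 1)%R.

Lemma integral_label (p : fdist R 'I_k.+1) (f : 'I_k.+1 -> \bar R) :
  (forall j, 0 <= f j) ->
  \int[label_prob p]_j f j = \sum_j (p j)%:E * f j.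
Proof.
move=> f0.
rewrite (@integral_mixture _ _ _ _ p (fun j => \d_j))//; last exact: fdist_ge0.
by apply: eq_bigr => j _; rewrite integral_dirac//= diracT mul1e.
Qed.

(** The labels are independent and the operators linear, so averaging the product over the labels
    averages each factor; [pE] says what the averaged factor is. *)
Lemma integral_label_thins n (p : 'I_n -> fdist R 'I_k.+1) (g : 'I_n -> R)
    (M : 'I_n -> probability Y R) G S :
  (forall i, (0 <= g i <= 1)%R) ->
  (forall i F S, nnmeasurable F ->
    \sum_j (p i j)%:E * thin (theta j) (Q j) F S = thin (g i) (M i) F S) ->
  nnmeasurable G ->
  \int[independent (fun i => label_prob (p i))]_t thins theta Q t G S =
  thins g M (enum 'I_n) G S.
Proof.
move=> g01 pE; elim: n p g M g01 pE G => [|n IHn] p g M g01 pE G mG.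
  by rewrite integral_independent0 ?enum_ord0//; exact: measurable_fun_label_tuple.
rewrite integral_independentS; last 2 first.
- exact: measurable_fun_label_tuple.
- by move=> t; case: (nnmeasurable_thins Q theta01 t mG).
have mthin j : nnmeasurable (thin (theta j) (Q j) G) by exact: nnmeasurable_thin.
under eq_integral => j _.
  (* The operator of the first label is moved innermost, so that the induction hypothesis applies
     with [thin (theta j) (Q j) G] for [G]. *)
  under eq_integral do rewrite /= -thins_thin//.
  rewrite (IHn _ (fun i => g (lift ord0 i)) (fun i => M (lift ord0 i)))//; last first.
    by move=> i F S' mF; exact: pE.
  over.
have g'01 i : (0 <= g (lift ord0 i) <= 1)%R by [].
rewrite integral_label; last first.
  move=> j.
  by case: (nnmeasurable_thins (fun i => M (lift ord0 i)) g'01 (enum 'I_n) (mthin j)).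
rewrite -thins_sum//; last by move=> j; rewrite lee_fin fdist_ge0.
rewrite enum_ordSl /= (thins_map (lift ord0)).
rewrite (eq_thins _ _ _ _ (fun S => pE ord0 G S mG)).
by rewrite thins_thin.
Qed.

End label_integral.

(** * Binomial expansion *)

Lemma binomial_pmf0S (R : realType) n (p : R) :
  binomial_pmf n.+1 p 0 = (1 - p) * binomial_pmf n p 0.
Proof. by rewrite /binomial_pmf !bin0 !subn0 !expr0 !mul1r !mulr1n -exprS. Qed.

Lemma binomial_pmfSS (R : realType) n (p : R) m :
  binomial_pmf n.+1 p m.+1 =
  p * binomial_pmf n p m + (1 - p) * binomial_pmf n p m.+1.
Proof.
rewrite /binomial_pmf binS mulrnDr addrC subSS -!mulrnAr mulrA -exprS.
(* For [n <= m] the factor ['C(n, m.+1)] vanishes, which covers the truncated exponent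
   [n - m.+1]. *)
congr (_ + _); have [mn|nm] := ltnP m n; last by rewrite bin_small// !mulr0n !mulr0.
rewrite mulrCA; congr (_ * _).
by rewrite mulrnAr -exprS subnSK.
Qed.

Lemma binomial_pmf_small (R : realType) n (p : R) m :
  (n < m)%N -> binomial_pmf n p m = 0.
Proof. by move=> nm; rewrite /binomial_pmf bin_small. Qed.

Section binomial_expansion.
Local Open Scope ereal_scope.
Context d (Y : measurableType d) (R : realType).
Implicit Types (F : mset_of Y -> \bar R) (S : mset_of Y).

Lemma thins_lin (J : eqType) (theta : J -> R) (P : J -> probability Y R) (l : seq J)
    (a b : \bar R) F G S :
  (forall j, (0 <= theta j <= 1)%R) -> 0 <= a -> 0 <= b ->
  nnmeasurable F -> nnmeasurable G ->
  thins theta P l (fun S => a * F S + b * G S) S =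
  a * thins theta P l F S + b * thins theta P l G S.
Proof.
move=> theta01 a0 b0 mF mG.
pose c (i : bool) := if i then a else b; pose H i := if i then F else G.
have := @thins_sum _ _ _ _ theta P theta01 _ [:: true; false] c H l S.
rewrite !big_cons !big_nil !adde0 => <-; last 2 first.
- by case.
- by case.
by apply: eq_thins => S'; rewrite !big_cons big_nil adde0.
Qed.

Lemma thinsZ (J : eqType) (theta : J -> R) (P : J -> probability Y R) (l : seq J)
    (c : \bar R) F S :
  (forall j, (0 <= theta j <= 1)%R) -> 0 <= c -> nnmeasurable F ->
  thins theta P l (fun S => c * F S) S = c * thins theta P l F S.
Proof.
move=> theta01 c0 mF.
have := @thins_sum _ _ _ _ theta P theta01 _ [:: tt] (fun=> c) (fun=> F) l S.
rewrite big_seq1 => <-//.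
by apply: eq_thins => S'; rewrite big_seq1.
Qed.

(** The [m]-th power of the operator adding one sample of [omega]; all factors are equal, hence the
    index type [unit]. *)
Definition samples (omega : probability Y R) (m : nat) :=
  thins (fun=> 1%R) (fun=> omega) (nseq m tt).

Section expansion.
Variables (gamma : R) (omega : probability Y R) (J : eqType).
Variables (theta : J -> R) (P : J -> probability Y R).
Hypotheses (gamma01 : (0 <= gamma <= 1)%R)
  (theta01 : forall j, (0 <= theta j <= 1)%R).

(* The part of the expansion of a product of operators
   [gamma T + (1 - gamma) W_j], applied to F, that is m-homogeneous in T;
   T commutes with the W_j. *)
Fixpoint expansion_coef F (l : seq J) (m : nat) : mset_of Y -> \bar R :=
  if l is j :: l' then fun S =>
    gamma%:E * (if m is m'.+1 then expansion_coef F l' m' S else 0)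
    + (1 - gamma)%:E * thin (theta j) (P j) (expansion_coef F l' m) S
  else if m is 0 then F else cst 0.

Let g0 : 0 <= gamma%:E. Proof. by rewrite lee_fin; case/andP: gamma01. Qed.
Let g1 : 0 <= (1 - gamma)%:E.
Proof. by rewrite lee_fin subr_ge0; case/andP: gamma01. Qed.

Let nnmeasurable0 : nnmeasurable (cst 0 : mset_of Y -> \bar R). Proof. by []. Qed.

Lemma nnmeasurable_expansion_coef F l m :
  nnmeasurable F -> nnmeasurable (expansion_coef F l m).
Proof.
move=> mF; elim: l m => [|j l IHl] m /=; first by case: m.
have mpred :
    nnmeasurable (fun S => if m is m'.+1 then expansion_coef F l m' S else 0).
  by case: m.
have mthin := nnmeasurable_thin (P j) (theta01 j) (IHl m).
split.
  by apply: emeasurable_funD; apply: measurable_funeM; [case: mpred|case: mthin].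
move=> S; apply: adde_ge0; apply: mule_ge0 => //; [by case: mpred|by case: mthin].
Qed.

Lemma expansion_coef_small F l m S : (size l < m)%N -> expansion_coef F l m S = 0.
Proof.
elim: l m S => [|j l IHl] [|m]//= S lm.
rewrite IHl// mule0 add0e (@eq_thin _ _ _ _ _ _ (cst 0)) ?thin_cst ?mule0// => S'.
by rewrite IHl// ltnW.
Qed.

(** For the constant function 1 the recursion is Pascal's rule for the binomial weights, and the
    operators are monotone. This bound makes the quotient by the binomial weight a test. *)
Lemma expansion_coef_le F l m S : nnmeasurable F -> (forall S, F S <= 1) ->
  expansion_coef F l m S <= (binomial_pmf (size l) gamma m)%:E.
Proof.
move=> mF F1; elim: l m S => [|j l IHl] m S /=.
  case: m => [|m]; first by rewrite /binomial_pmf bin0 !expr0 mulr1 F1.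
  by rewrite binomial_pmf_small.
have thin_le : thin (theta j) (P j) (expansion_coef F l m) S <=
    (binomial_pmf (size l) gamma m)%:E.
  rewrite -[leRHS](thin_cst (theta j) (P j) _ S); apply: le_thin => //.
    exact: nnmeasurable_expansion_coef.
  by split=> // S'; rewrite lee_fin binomial_pmf_ge0.
case: m thin_le => [|m] thin_le.
  by rewrite mule0 add0e binomial_pmf0S EFinM lee_wpmul2l.
by rewrite binomial_pmfSS [leRHS]EFinD !EFinM leeD// lee_wpmul2l.
Qed.

(** Every [W_j] is then the identity, so only the binomial weights of the recursion survive. *)
Lemma expansion_coef_id F l m S : (forall j, theta j = 0%R) ->
  expansion_coef F l m S = (binomial_pmf (size l) gamma m)%:E * F S.
Proof.
move=> theta0; elim: l m S => [|j l IHl] m S /=.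
  case: m => [|m]; first by rewrite /binomial_pmf bin0 !expr0 mulr1 mul1e.
  by rewrite binomial_pmf_small// mul0e.
rewrite theta0 thin0E IHl; case: m => [|m].
  by rewrite mule0 add0e binomial_pmf0S EFinM muleA.
rewrite IHl !muleA -!EFinM binomial_pmfSS [in RHS]EFinD ge0_muleDl// lee_fin.
- by rewrite mulr_ge0 ?binomial_pmf_ge0//; case/andP: gamma01.
- by rewrite mulr_ge0 ?binomial_pmf_ge0 ?subr_ge0//; case/andP: gamma01.
Qed.

Let one01 : forall u : unit, (0 <= (1 : R) <= 1)%R.
Proof. by move=> _; rewrite ler01 lexx. Qed.

Lemma nnmeasurable_samples m F : nnmeasurable F -> nnmeasurable (samples omega m F).
Proof. exact: nnmeasurable_thins. Qed.

(** Each factor has the form [gamma T + (1 - gamma) W_j] with [T] commuting with every [W_j], so the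
    powers of [T] are collected in front as in the binomial theorem. *)
Lemma thins_expansion (g : J -> R) (M : J -> probability Y R) F l S :
  (forall j F S, nnmeasurable F -> thin (g j) (M j) F S =
     gamma%:E * thin 1 omega F S + (1 - gamma)%:E * thin (theta j) (P j) F S) ->
  nnmeasurable F ->
  thins g M l F S = \sum_(m < (size l).+1) samples omega m (expansion_coef F l m) S.
Proof.
move=> gE mF; elim: l S => [|j l IHl] S /=.
  by rewrite big_ord_recl big_ord0 adde0.
have mcoef m := nnmeasurable_expansion_coef l m mF.
have mT m : nnmeasurable (samples omega m (expansion_coef F l m)).
  exact: nnmeasurable_samples.
rewrite (eq_thin _ _ _ IHl) gE; last first.
  split; first by apply: emeasurable_sum => m; case: (mT m).
  by move=> S'; apply: sume_ge0 => m _; case: (mT m).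
have sum1 a (Q : probability Y R) : (0 <= a <= 1)%R ->
    thin a Q (fun S =>
      \sum_(m < (size l).+1) samples omega m (expansion_coef F l m) S) S =
    \sum_(m < (size l).+1) thin a Q (samples omega m (expansion_coef F l m)) S.
  move=> a01; rewrite (@eq_thin _ _ _ _ _ _
    (fun S => \sum_(m < (size l).+1)
       1 * samples omega m (expansion_coef F l m) S)); last first.
    by move=> S'; apply: eq_bigr => m _; rewrite mul1e.
  by rewrite thin_sum//; apply: eq_bigr => m _; rewrite mul1e.
rewrite !sum1//; last exact: one01 tt.
have mpred m :
    nnmeasurable (fun S => if m is m'.+1 then expansion_coef F l m' S else 0).
  by case: m.
have mthin m := nnmeasurable_thin (P j) (theta01 j) (mcoef m).
under [RHS]eq_bigr => m _.
  rewrite /samples thins_lin//.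
  rewrite (thins_thin _ one01)//.
  over.
(* The sum for [j :: l] has one more index: the [gamma] part is shifted by one and vanishes at
   [m = 0], the other part vanishes at the last index. *)
rewrite /= [RHS]big_split/=; congr (_ + _).
  rewrite [RHS]big_ord_recl /= mule0 add0e ge0_sume_distrr//.
  by move=> m _; case: (nnmeasurable_thin omega (one01 tt) (mT m)).
rewrite [RHS]big_ord_recr /= [X in _ = _ + X](_ : _ = 0) ?adde0.
  rewrite ge0_sume_distrr// => m _.
  by case: (nnmeasurable_thin (P j) (theta01 j) (mT m)).
rewrite (@eq_thin _ _ _ _ _ _ (cst 0)) ?thin_cst ?mule0// => S'.
rewrite (@eq_thin _ _ _ _ _ _ (cst 0)) ?thin_cst// => S1.
rewrite (@eq_thins _ _ _ _ _ _ _ _ (cst 0)) ?thins_cst// => S2.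
by rewrite expansion_coef_small.
Qed.

End expansion.

End binomial_expansion.

(** * The privacy blanket *)

Section densities_theory.
Local Open Scope ereal_scope.
Context d (Y : measurableType d) (R : realType) (mu : {measure set Y -> \bar R}).

(** [e] is the normalization of [h - g], whose mass is [H - G]. *)
Lemma density_remainder (h g : Y -> R) (H G : R) (e0 : density mu) :
  measurable_fun setT h -> measurable_fun setT g ->
  (forall y, (0 <= g y <= h y)%R) ->
  \int[mu]_y (h y)%:E = H%:E -> \int[mu]_y (g y)%:E = G%:E ->
  (G <= H)%R /\ exists e : density mu, forall A, measurable A ->
    \int[mu]_(y in A) (h y)%:E =
    \int[mu]_(y in A) (g y)%:E + (H - G)%:E * density_prob e A.
Proof.
move=> mh mg gh hE gE.
pose f y := (h y - g y)%R.
have mf : measurable_fun setT f by exact: measurable_funB.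
have mEf A (u : Y -> R) : measurable_fun setT u ->
    measurable_fun A (fun y => (u y)%:E).
  by move=> mu'; apply/measurable_funTS/measurable_EFinP.
have f0 y : (0 <= f y)%R by rewrite subr_ge0; case/andP: (gh y).
have g0 y : (0 <= g y)%R by case/andP: (gh y).
have split A : measurable A -> \int[mu]_(y in A) (h y)%:E =
    \int[mu]_(y in A) (g y)%:E + \int[mu]_(y in A) (f y)%:E.
  move=> mA; rewrite -ge0_integralD//; try by [move=> *; rewrite lee_fin|exact: mEf].
  by apply: eq_integral => y _; rewrite -EFinD addrC subrK.
have fE : \int[mu]_y (f y)%:E = (H - G)%:E.
  by rewrite EFinB -hE (split setT)// gE addeAC subee// add0e.
have GH : (G <= H)%R.
  by rewrite -subr_ge0 -lee_fin -fE; apply: integral_ge0 => y _; rewrite lee_fin.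
split=> //; have [HG|HG] := eqVneq (H - G)%R 0%R.
  (* Without mass to normalize, the witness is [e0] with coefficient 0, and [h - g] integrates to 0
     on [A]. *)
  exists e0 => A mA; rewrite split// HG mul0e; congr (_ + _).
  apply/eqP; rewrite eq_le; apply/andP; split; last first.
    by apply: integral_ge0 => y _; rewrite lee_fin.
  rewrite -[leRHS]/(0%R%:E) -HG -fE; apply: ge0_subset_integral => //; first exact: mEf.
  by move=> y _; rewrite lee_fin.
have HG0 : (0 < H - G)%R by rewrite lt_neqAle eq_sym HG subr_ge0.
have mfD : measurable_fun setT (fun y => (H - G)^-1 * f y)%R.
  exact: measurable_funM.
have fD0 y : (0 <= (H - G)^-1 * f y)%R by rewrite mulr_ge0// invr_ge0 ltW.
have intfD A : measurable A ->
    \int[mu]_(y in A) ((H - G)^-1 * f y)%:E =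
    ((H - G)^-1)%:E * \int[mu]_(y in A) (f y)%:E.
  move=> mA; under eq_integral do rewrite EFinM.
  rewrite ge0_integralZl//; first exact: mEf.
    by move=> y _; rewrite lee_fin.
  by rewrite lee_fin invr_ge0 ltW.
have fD1 : \int[mu]_y ((H - G)^-1 * f y)%:E = 1.
  by rewrite intfD// fE -EFinM mulVf.
exists (Density mfD fD0 fD1) => A mA; rewrite split//; congr (_ + _).
by rewrite /density_prob/= intfD// muleA -EFinM divff// mul1e.
Qed.

Lemma density_probZ (c : R) (q : density mu) A : (0 <= c)%R -> measurable A ->
  \int[mu]_(y in A) (c * q y)%:E = c%:E * density_prob q A.
Proof.
move=> c0 mA; under eq_integral do rewrite EFinM.
rewrite ge0_integralZl//.
- exact/measurable_funTS/measurable_EFinP/measurable_density.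
- by move=> y _; rewrite lee_fin density_ge0.
Qed.

Lemma density_prob_sum k (c : 'I_k -> R) (Q : 'I_k -> density mu) A :
  (forall j, (0 <= c j)%R) -> measurable A ->
  \int[mu]_(y in A) (\sum_j c j * Q j y)%R%:E = \sum_j (c j)%:E * density_prob (Q j) A.
Proof.
move=> c0 mA; under eq_integral do rewrite -sumEFin.
rewrite ge0_integral_sum//.
- by apply: eq_bigr => j _; rewrite density_probZ.
- move=> j; apply/measurable_funTS/measurable_EFinP/measurable_funM => //.
  exact: measurable_density.
- by move=> j y _; rewrite lee_fin mulr_ge0// density_ge0.
Qed.

End densities_theory.

Section blanket.
Local Open Scope ereal_scope.
Context d (Y : measurableType d) (R : realType) (mu : {measure set Y -> \bar R}).
Context (X : Type) (r : X -> density mu) (x0 : X) (omega : density mu).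
Hypotheses (minf : measurable_fun setT (blanket_inf r))
  (omegaP : is_blanket r omega).
Local Notation gamma := (blanket_gamma r).

Lemma blanket_inf_le x y : (blanket_inf r y <= r x y)%R.
Proof.
apply: ge_inf; last by exists x.
by exists 0%R => _ [x' _ <-]; exact: density_ge0.
Qed.

(** The point [x0] makes the set of values nonempty, as a greatest lower bound in the reals
    requires. *)
Lemma le_blanket_inf y (a : R) : (forall x, (a <= r x y)%R) -> (a <= blanket_inf r y)%R.
Proof.
move=> ar; apply: lb_le_inf; first by exists (r x0 y), x0.
by move=> _ [x' _ <-].
Qed.

Let inf_ge0 y : (0 <= blanket_inf r y)%R.
Proof. by apply: le_blanket_inf => x; exact: density_ge0. Qed.

Let int_inf_le1 : \int[mu]_y (blanket_inf r y)%:E <= 1.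
Proof.
rewrite -(density_int1 (r x0)); apply: ge0_le_integral => //.
- by move=> y _; rewrite lee_fin.
- exact/measurable_EFinP.
- exact/measurable_EFinP/measurable_density.
- by move=> y _; rewrite lee_fin blanket_inf_le.
Qed.

(** [blanket_gamma] is a real-valued integral; domination by the density [r x0] makes the extended
    integral finite, so the two agree. *)
Lemma blanket_gammaE : \int[mu]_y (blanket_inf r y)%:E = gamma%:E.
Proof.
rewrite /blanket_gamma /Rintegral fineK// ge0_fin_numE.
  by apply: le_lt_trans int_inf_le1 _; rewrite ltry.
by apply: integral_ge0 => y _; rewrite lee_fin.
Qed.

Lemma blanket_gamma01 : (0 <= gamma <= 1)%R.
Proof.
rewrite -!lee_fin -blanket_gammaE int_inf_le1 andbT.
by apply: integral_ge0 => y _; rewrite lee_fin.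
Qed.

Let gamma0 : (0 <= gamma)%R. Proof. by case/andP: blanket_gamma01. Qed.

Let gamma_omega_ge0 y : (0 <= gamma * omega y)%R.
Proof. by rewrite mulr_ge0// density_ge0. Qed.

Let gamma_omega_le x y : (gamma * omega y <= r x y)%R.
Proof.
(* When [gamma = 0], [omega] is arbitrary but the product [gamma * omega] is 0. *)
have [->|g0] := eqVneq gamma 0%R; first by rewrite mul0r density_ge0.
by rewrite omegaP// mulrCA divff// mulr1 blanket_inf_le.
Qed.

Let measurable_gamma_omega : measurable_fun setT (fun y => gamma * omega y)%R.
Proof. by apply: measurable_funM => //; exact: measurable_density. Qed.

Let int_gamma_omega : \int[mu]_y (gamma * omega y)%:E = gamma%:E.
Proof. by rewrite density_probZ// [density_prob _ _]density_int1 mule1. Qed.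

Lemma blanket_leftover x : exists e : density mu, forall A, measurable A ->
  density_prob (r x) A =
  gamma%:E * density_prob omega A + (1 - gamma)%:E * density_prob e A.
Proof.
have [|_ [e eE]] := density_remainder (r x) (measurable_density (r x))
    measurable_gamma_omega _ (density_int1 (r x)) int_gamma_omega.
  by move=> y; rewrite gamma_omega_ge0 gamma_omega_le.
by exists e => A mA; rewrite -density_probZ//; exact: eE.
Qed.

(** The density [\sum_j c_j Q_j] lies below every [r x], hence below their infimum, and integrating
    gives the first claim. *)
Lemma blanket_clone x1 k (D : clone_decomposition r x0 x1 k) :
  (\sum_j cd_c D j <= gamma)%R /\
  exists e : density mu, forall A, measurable A ->
    gamma%:E * density_prob omega A =
    \sum_j (cd_c D j)%:E * density_prob (cd_Q D j) A
    + (gamma - \sum_j cd_c D j)%:E * density_prob e A.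
Proof.
pose q y := (\sum_j cd_c D j * cd_Q D j y)%R.
have q0 y : (0 <= q y)%R.
  by apply: sumr_ge0 => j _; rewrite mulr_ge0 ?cd_c_ge0 ?density_ge0.
have mq : measurable_fun setT q.
  apply: measurable_sum => j; apply: measurable_funM => //.
  exact: measurable_density.
have intq : \int[mu]_y (q y)%:E = (\sum_j cd_c D j)%R%:E.
  rewrite density_prob_sum//; last exact: cd_c_ge0.
  rewrite -sumEFin; apply: eq_bigr => j _.
  by rewrite [density_prob _ _]density_int1 mule1.
have q_inf y : (q y <= blanket_inf r y)%R.
  apply: le_blanket_inf => x; rewrite (cd_xE D) lerDl.
  by rewrite mulr_ge0 ?cd_beta_ge0 ?density_ge0.
have Cgamma : (\sum_j cd_c D j <= gamma)%R.
  rewrite -lee_fin -intq -blanket_gammaE.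
  by apply: ge0_le_integral => // *; rewrite ?lee_fin//; exact/measurable_EFinP.
have q_le y : (q y <= gamma * omega y)%R.
  have [g0|g0] := eqVneq gamma 0%R; last first.
    by rewrite omegaP// mulrCA divff// mulr1.
  (* With [gamma = 0] the inequality just proved forces every [c_j] to be 0, whatever [omega] is. *)
  have C0 : (\sum_j cd_c D j = 0)%R.
    apply: le_anti; move: Cgamma; rewrite g0 => ->/=.
    by apply: sumr_ge0 => j _; exact: cd_c_ge0.
  have c0 j : cd_c D j = 0%R.
    by apply: (psumr_eq0P _ C0) => // i _; exact: cd_c_ge0.
  by rewrite /q big1 ?g0 ?mul0r// => j _; rewrite c0 mul0r.
split=> //; have [|_ [e eE]] := density_remainder omega
    measurable_gamma_omega mq _ int_gamma_omega intq.
  by move=> y; rewrite q0 q_le.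
exists e => A mA; rewrite -density_probZ// -density_prob_sum//.
- exact: eE.
- exact: cd_c_ge0.
Qed.

End blanket.

Lemma integral_one_and_rest d (Y : measurableType d) (R : realType) m
    (P Q : probability Y R) (F : mset_of Y -> \bar R) :
  nnmeasurable F ->
  (\int[one_and_rest m P Q]_t F (seq_mset t) = thin 1 P (samples Q m F) mset0)%E.
Proof.
move=> mF; rewrite integral_seq_mset// enum_ordSl /= (thins_map (lift ord0)).
apply: eq_thin => S; rewrite /samples /thins /=.
by elim: m S => [|m IHm] S; rewrite ?enum_ord0// enum_ordSl/= foldr_map; apply: eq_thin.
Qed.

Section blanket_integral.
Local Open Scope ereal_scope.
Context d (Y : measurableType d) (R : realType) (mu : {measure set Y -> \bar R}).
Context (X : Type) (r : X -> density mu) (x0 : X) (omega : density mu) (n : nat).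
Hypotheses (minf : measurable_fun setT (blanket_inf r)).
Local Notation gamma := (blanket_gamma r).

Lemma blanket_pairE x A : measurable A -> blanket_pair r n omega x A =
  \sum_(m < n.+1) (binomial_pmf n gamma m)%:E *
    one_and_rest m (density_prob (r x)) (density_prob omega)
      (@sized_multiset _ Y m @^-1` A).
Proof.
move=> mA; have /andP[g0 g1] := blanket_gamma01 x0 minf.
by rewrite /blanket_pair /= /pbind (integral_binomial n (p0 := g0) g1).
Qed.

Lemma integral_blanket_pair x (phi : nat * mset_of Y -> \bar R) :
  measurable_fun setT phi -> (forall z, 0 <= phi z) ->
  \int[blanket_pair r n omega x]_z phi z =
  \sum_(m < n.+1) (binomial_pmf n gamma m)%:E *
    \int[one_and_rest m (density_prob (r x)) (density_prob omega)]_t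
      phi (val m, seq_mset t : mset_of Y).
Proof.
move=> mphi phi0.
rewrite (@integral_mixture _ _ _ _ (fun m : 'I_n.+1 => binomial_pmf n gamma m)
  (fun m => distribution (one_and_rest m (density_prob (r x)) (density_prob omega))
     (@sized_multiset _ Y m)))//.
- by apply: eq_bigr => m _; rewrite ge0_integral_distribution.
- by move=> m; apply: binomial_pmf_ge0; exact: blanket_gamma01 minf.
- by move=> A mA; exact: blanket_pairE.
Qed.

End blanket_integral.

Lemma measurable_fun_nat_prod d (T : measurableType d) d' (U : measurableType d')
    (f : nat * T -> U) :
  (forall m, measurable_fun setT (fun x => f (m, x))) -> measurable_fun setT f.
Proof.
move=> mf _ B mB; rewrite setTI.
rewrite (_ : _ @^-1` _ = \bigcup_m ([set m] `*` ((fun x => f (m, x)) @^-1` B))).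
  apply: bigcup_measurable => m _; apply: measurableX => //.
  by rewrite -[X in measurable X]setTI; exact: mf.
apply/seteqP; split=> [[m x] /= Bmx|[m x] [_ _ [/= -> ?]]//].
by exists m.
Qed.

(** * From the blanket pair to the shuffled outputs *)

Section shuffle_integral.
Local Open Scope ereal_scope.
Context d (Y : measurableType d) (R : realType) (N : nat) (A : set (N.-tuple Y)).
Hypothesis mA : measurable A.

Let c : R := (#|{perm 'I_N}|%:R)^-1.

Let c0 : 0 <= c%:E. Proof. by rewrite lee_fin invr_ge0. Qed.

Let avg (t : N.-tuple Y) : \bar R :=
  \sum_(s : {perm 'I_N}) c%:E * (\1_A (permute s t))%:E.

(** The probability that a uniformly random ordering of [S] lies in [A]; multisets of size other
    than [N] get the default 0. *)
Definition shuffle_test (S : mset_of Y) : \bar R :=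
  if insub (mset_enum S) is Some t then avg t else 0.

(** Translation in the permutation group reindexes the average, so it depends only on the
    multiset. *)
Let perm_avg (t t' : N.-tuple Y) : perm_eq t t' -> avg t = avg t'.
Proof.
move=> /tuple_permP[p tt']; rewrite /avg [RHS](reindex_inj (mulIg p)).
apply: eq_bigr => s _; congr (_ * (\1_A _)%:E); apply: eq_from_tnth => i.
rewrite !tnth_mktuple permM.
by rewrite (_ : t = [tuple tnth t' (p i) | i < N]) ?tnth_mktuple//; exact: val_inj.
Qed.

Let shuffle_testE (t : N.-tuple Y) : shuffle_test (seq_mset t) = avg t.
Proof.
rewrite /shuffle_test; have tS := perm_eq_seq_mset t.
case: insubP => [u _ ut|]; last by rewrite (perm_size tS) size_tuple eqxx.
by apply: perm_avg; rewrite ut.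
Qed.

Let measurable_permute_indic (s : {perm 'I_N}) :
  measurable_fun setT (fun t : N.-tuple Y => (\1_A (permute s t) : R)%:E).
Proof.
by apply/measurable_EFinP; apply: measurableT_comp => //; exact: measurable_indic.
Qed.

Lemma nnmeasurable_shuffle_test : nnmeasurable shuffle_test.
Proof.
split; last first.
  move=> S; rewrite /shuffle_test; case: insub => // t.
  by apply: sume_ge0 => s _; rewrite mule_ge0// lee_fin.
apply/measurable_fun_msetP => m; have [<-|mN] := eqVneq N m.
  under eq_fun do rewrite shuffle_testE.
  by apply: emeasurable_sum => s; exact: measurable_funeM.
rewrite (_ : (fun _ => _) = cst 0)//; apply/funext => t.
rewrite /shuffle_test insubF// (perm_size (perm_eq_seq_mset t)) size_tuple.
by rewrite eq_sym (negbTE mN).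
Qed.

Lemma shuffle_test_le1 S : shuffle_test S <= 1.
Proof.
rewrite /shuffle_test; case: insub => // t.
rewrite -[leRHS]/(1%R%:E) -(fdist_sum1 (fdist_uniform R (1%g : {perm 'I_N}))) -sumEFin.
apply: lee_sum => s _; rewrite -[leRHS]mule1 lee_wpmul2l// lee_fin.
by rewrite indicE; case: (_ \in _).
Qed.

Lemma integral_shuffle_test (P : probability (N.-tuple Y) R) :
  shuffle P A = \int[P]_t shuffle_test (seq_mset t).
Proof.
under [RHS]eq_integral do rewrite shuffle_testE.
rewrite ge0_integral_sum//; last 2 first.
- by move=> s; exact: measurable_funeM.
- by move=> s t _; rewrite mule_ge0// lee_fin.
apply: eq_bigr => s _; rewrite ge0_integralZl//.
congr (_ * _); rewrite /distribution /pushforward.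
have mAs : measurable (permute s @^-1` A).
  by rewrite -[X in measurable X]setTI; exact: measurable_funPT.
by rewrite -[RHS]/(\int[P]_x (\1_(permute s @^-1` A) x)%:E) integral_indic// setIT.
Qed.

End shuffle_integral.

Section shuffled_test.
Local Open Scope ereal_scope.
Context d (Y : measurableType d) (R : realType) (mu : {measure set Y -> \bar R}).
Context (X : Type) (r : X -> density mu) (x0 : X) (omega : density mu) (n : nat).
Hypotheses (minf : measurable_fun setT (blanket_inf r))
  (omegaP : is_blanket r omega).
Local Notation gamma := (blanket_gamma r).

(** The operators of the other [n] users are expanded along [r x_i = gamma omega + (1 - gamma) L_i].
    Where the binomial weight is positive, [phi (m, S)] is the probability that [S], completed by
    leftover samples of [n - m] random users and shuffled, falls in [A]. It does not involve [x], so
    one test serves both inputs. *)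
Lemma shuffled_blanket_test (xs : n.-tuple X) (A : set (n.+1.-tuple Y)) :
  measurable A ->
  exists phi : nat * mset_of Y -> \bar R,
    [/\ measurable_fun setT phi, forall z, 0 <= phi z <= 1 &
      forall x, shuffled r [tuple of x :: xs] A =
        \int[blanket_pair r n omega x]_z phi z].
Proof.
move=> mA; have gamma01 := blanket_gamma01 x0 minf.
have /choice[L LE] : forall x, exists e : density mu, forall A, measurable A ->
    density_prob (r x) A =
    gamma%:E * density_prob omega A + (1 - gamma)%:E * density_prob e A.
  by move=> x; exact: blanket_leftover.
pose F : mset_of Y -> \bar R := shuffle_test R A.
have mF : nnmeasurable F := nnmeasurable_shuffle_test R mA.
have one01 (j : 'I_n) : (0 <= (1 : R) <= 1)%R by rewrite ler01 lexx.
pose P (i : 'I_n) : probability Y R := density_prob (L (tnth xs i)).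
pose M (i : 'I_n) : probability Y R := density_prob (r (tnth xs i)).
pose H m := expansion_coef gamma (fun=> 1%R) P F (enum 'I_n) m.
have mH m : nnmeasurable (H m) by exact: nnmeasurable_expansion_coef.
have pmf0 m : (0 <= binomial_pmf n gamma m)%R by exact: binomial_pmf_ge0.
have H_le m S : H m S <= (binomial_pmf n gamma m)%:E.
  rewrite -[n in binomial_pmf n]size_enum_ord.
  by apply: expansion_coef_le => // S'; exact: shuffle_test_le1.
(* phi vanishes where the binomial weight does, and so does H there. *)
pose phi (z : nat * mset_of Y) := ((binomial_pmf n gamma z.1)^-1)%:E * H z.1 z.2.
have phi0 z : 0 <= phi z.
  by rewrite mule_ge0 ?lee_fin ?invr_ge0//; case: (mH z.1).
have pmf_phi m S : (binomial_pmf n gamma m)%:E * phi (m, S) = H m S.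
  rewrite /phi/= muleA -EFinM; have [p0|p0] := eqVneq (binomial_pmf n gamma m) 0%R.
    have := H_le m S; rewrite p0 mul0r mul0e => H0.
    by apply/esym/eqP; rewrite eq_le H0/=; case: (mH m).
  by rewrite divff// mul1e.
have mphi m : nnmeasurable (fun S => phi (m, S)).
  by split=> //; rewrite /phi/=; apply: measurable_funeM; case: (mH m).
exists phi; split.
- by apply: measurable_fun_nat_prod => m; case: (mphi m).
- move=> z; rewrite phi0/=.
  have [p0|p0] := eqVneq (binomial_pmf n gamma z.1) 0%R.
    by rewrite /phi p0 invr0 mul0e.
  have p1 : (0 < binomial_pmf n gamma z.1)%R by rewrite lt_neqAle eq_sym p0/=.
  by rewrite /phi lee_pdivrMl// mule1.
move=> x; rewrite integral_blanket_pair//; last first.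
  by apply: measurable_fun_nat_prod => m; case: (mphi m).
rewrite /shuffled integral_shuffle_test// integral_seq_mset// enum_ordSl /=.
rewrite (thins_map (lift ord0)) tnth0.
rewrite (_ : _ \o lift ord0 = M); last first.
  by apply/funext => i /=; rewrite tnthS.
have pmfe0 m : 0 <= (binomial_pmf n gamma m)%:E by rewrite lee_fin.
have unit01 (u : unit) : (0 <= (1 : R) <= 1)%R by rewrite ler01 lexx.
have samplesE S : thins (fun=> 1%R) M (enum 'I_n) F S =
    \sum_(m < n.+1) (binomial_pmf n gamma m)%:E *
      samples (density_prob omega) m (fun S => phi (val m, S)) S.
  rewrite (thins_expansion gamma01 one01 (omega := density_prob omega) (P := P))//.
    rewrite size_enum_ord; apply: eq_bigr => m _.
    rewrite /samples -thinsZ//; apply: eq_thins => S'.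
    by rewrite pmf_phi.
  move=> j G S' [mG G0]; rewrite !thin1E.
  have /andP[g0 g1] := gamma01.
  apply: integral_mixture2 => //; first by rewrite subr_ge0.
  - by move=> B mB; exact: LE.
  - exact: measurable_mset_add.
rewrite (eq_thin _ _ _ samplesE) thin_sum//.
- by apply: eq_bigr => m _; rewrite -integral_one_and_rest.
- by rewrite ler01 lexx.
- by move=> m; exact: nnmeasurable_samples.
Qed.

End shuffled_test.

(** * From the clone histogram to the blanket pair *)

Section filling_kernel.
Local Open Scope ereal_scope.
Context d (Y : measurableType d) (R : realType) (k : nat).
Variables (theta : 'I_k.+1 -> R) (Q : 'I_k.+1 -> probability Y R).
Hypothesis theta01 : forall j, (0 <= theta j <= 1)%R.

(** The multiset contains the first user's sample besides the [|b|] blanket ones, so [|b|] is the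
    size minus one. *)
Definition indexed_mset (S : mset_of Y) : nat * mset_of Y :=
  ((size (mset_enum S)).-1, S).

Lemma indexed_seq_mset m (t : m.-tuple Y) :
  indexed_mset (seq_mset t) = (m.-1, seq_mset t : mset_of Y).
Proof. by rewrite /indexed_mset (perm_size (perm_eq_seq_mset t)) size_tuple. Qed.

Definition indexed_dirac (B : set (nat * mset_of Y)) (S : mset_of Y) : \bar R :=
  \d_(indexed_mset S) B.

Lemma nnmeasurable_indexed_dirac B : measurable B -> nnmeasurable (indexed_dirac B).
Proof.
move=> mB; split=> //; apply/measurable_fun_msetP => m.
rewrite /indexed_dirac; under eq_fun do rewrite indexed_seq_mset.
have mseq : measurable_fun setT (fun t : m.-tuple Y => (m.-1, seq_mset t : mset_of Y)).
  apply: measurable_fun_pair => //.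
  exact: ((measurable_fun_msetP (fun S : mset_of Y => S)).1 _ m).
apply/measurable_EFinP.
exact: (measurableT_comp (measurable_indic (R := R) mB) mseq).
Qed.

(** A sequence with histogram [h]; its order is immaterial by [perm_thins]. *)
Definition labels (h : k.+1.-tuple nat) : seq 'I_k.+1 :=
  flatten [seq nseq (tnth h j) j | j <- enum 'I_k.+1].

Lemma perm_labels n (t : n.-tuple 'I_k.+1) : perm_eq (labels (histogram t)) t.
Proof.
apply/allP => j _ /=; rewrite count_flatten -map_comp sumnE big_map big_enum /=.
rewrite (bigD1 j)//= count_nseq /= eqxx mul1n tnth_mktuple big1 ?addn0//.
by move=> i ij; rewrite count_nseq /= (negbTE ij).
Qed.

(* Law of the multiset obtained by drawing, for every label j recorded in h,
   a sample of Q j, kept with probability theta j. *)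
Definition filling (h : k.+1.-tuple nat) (B : set (nat * mset_of Y)) : \bar R :=
  thins theta Q (labels h) (indexed_dirac B) mset0.

Section filling_measure.
Variable h : k.+1.-tuple nat.

Let filling0 : filling h set0 = 0.
Proof.
rewrite /filling (@eq_thins _ _ _ _ _ _ _ _ (cst 0)) ?thins_cst// => S.
by rewrite /indexed_dirac measure0.
Qed.

(* nnmeasurable_thins does not apply: B need not be measurable. *)
Let filling_ge0 B : 0 <= filling h B.
Proof.
rewrite /filling; elim: (labels h) mset0 => [|j l IHl] S //=.
have /andP[t0 t1] := theta01 j.
by rewrite adde_ge0// mule_ge0 ?lee_fin ?subr_ge0//; exact: integral_ge0.
Qed.

Let filling_sigma_additive : semi_sigma_additive (filling h).
Proof.
move=> F mF tF mUF.
have mdirac i := nnmeasurable_indexed_dirac (mF i).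
rewrite [X in _ --> X](_ : _ = \sum_(i <oo) filling h (F i)).
  by apply: is_cvg_nneseries => i _ _; exact: filling_ge0.
rewrite /filling -thins_nneseries//; apply: eq_thins => S.
by apply/esym/cvg_lim => //; exact: measure_semi_sigma_additive.
Qed.

HB.instance Definition _ := isMeasure.Build _ _ _ (filling h)
  filling0 filling_ge0 filling_sigma_additive.

End filling_measure.

Definition filling_kernel (h : k.+1.-tuple nat) :
  {measure set (nat * mset_of Y) -> \bar R} := filling h.

Let measurable_filling B : measurable B -> measurable_fun setT (filling_kernel ^~ B).
Proof. by move=> _; exact: measurable_fun_nat_tuple. Qed.

HB.instance Definition _ := isKernel.Build _ _ _ _ _ filling_kernel
  measurable_filling.

Let filling_prob h : filling_kernel h setT = 1.
Proof.
rewrite /filling_kernel/= /filling (@eq_thins _ _ _ _ _ _ _ _ (cst 1%:E)) ?thins_cst//.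
by move=> S; rewrite /indexed_dirac diracT.
Qed.

HB.instance Definition _ := Kernel_isProbability.Build _ _ _ _ _ filling_kernel
  filling_prob.

End filling_kernel.

Section thin_mixture.
Local Open Scope ereal_scope.
Context d (Y : measurableType d) (R : realType) (k : nat).

Lemma thin_mixture (p : fdist R 'I_k.+1) (theta : 'I_k.+1 -> R)
    (Q : 'I_k.+1 -> probability Y R) (g : R) (M : probability Y R) F S :
  (forall j, (0 <= theta j <= 1)%R) -> (0 <= g <= 1)%R ->
  (forall A, measurable A -> \sum_j (p j * theta j)%:E * Q j A = g%:E * M A) ->
  nnmeasurable F ->
  \sum_j (p j)%:E * thin (theta j) (Q j) F S = thin g M F S.
Proof.
move=> theta01 /andP[g0 g1] QM [mF F0].
have t0 j : (0 <= theta j)%R by case/andP: (theta01 j).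
have t1 j : (0 <= 1 - theta j)%R by rewrite subr_ge0; case/andP: (theta01 j).
have p0 j : (0 <= p j)%R by exact: fdist_ge0.
(* Evaluating the hypothesis at the full space shows that the kept masses add up to [g]; the dropped
   masses then add up to [1 - g]. *)
have sum_g : (\sum_j p j * theta j = g)%R.
  have := QM _ measurableT; rewrite probability_setT mule1.
  by under eq_bigr do rewrite probability_setT mule1; rewrite sumEFin => -[].
under eq_bigr => j _.
  rewrite /thin ge0_muleDr; last 2 first.
    by rewrite mule_ge0 ?lee_fin//; exact: integral_ge0.
    by rewrite mule_ge0 ?lee_fin.
  rewrite !muleA -!EFinM.
  over.
rewrite /= big_split/=; congr (_ + _).
  rewrite -(integral_mixture (M := mscale (NngNum g0) M))//.
  - by rewrite ge0_integral_mscale//; exact: measurable_mset_add.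
  - by move=> j; rewrite mulr_ge0.
  - by move=> A mA; rewrite QM.
  - exact: measurable_mset_add.
rewrite -ge0_sume_distrl; last by move=> j _; rewrite lee_fin mulr_ge0.
rewrite sumEFin; congr (_%:E * _).
under eq_bigr do rewrite mulrBr mulr1.
by rewrite big_split/= sumrN fdist_sum1 sum_g.
Qed.

End thin_mixture.

Section clone_post_processing.
Local Open Scope ereal_scope.
Context d (Y : measurableType d) (R : realType) (mu : {measure set Y -> \bar R}).
Context (X : Type) (r : X -> density mu) (x0 x1 : X) (k : nat).
Context (D : clone_decomposition r x0 x1 k) (omega : density mu) (n : nat).
Hypotheses (minf : measurable_fun setT (blanket_inf r))
  (omegaP : is_blanket r omega).
Local Notation gamma := (blanket_gamma r).
Local Notation C := (\sum_j cd_c D j)%R.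

Variable e : density mu.
Hypothesis eE : forall A, measurable A ->
  gamma%:E * density_prob omega A =
  \sum_j (cd_c D j)%:E * density_prob (cd_Q D j) A
  + (gamma - C)%:E * density_prob e A.

Let gamma01 : (0 <= gamma <= 1)%R. Proof. exact: blanket_gamma01 minf. Qed.

Let C_le : (C <= gamma)%R. Proof. by have [] := blanket_clone minf omegaP D. Qed.

Let beta_gamma : (gamma - C <= cd_beta D)%R.
Proof. by rewrite lerBlDr (cd_c_sum1 D); case/andP: gamma01. Qed.

(* The last label stands for LO: it is turned into a sample of e with
   probability (gamma - C) / beta and dropped otherwise. *)
Definition keep (j : 'I_k.+1) : R :=
  if unlift ord_max j is Some _ then 1 else (gamma - C) / cd_beta D.

Definition content (j : 'I_k.+1) : probability Y R :=
  if unlift ord_max j is Some i then density_prob (cd_Q D i) else density_prob e.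

Lemma keep_prob j : (0 <= keep j <= 1)%R.
Proof.
rewrite /keep; case: unliftP => [_ _|_]; first by rewrite ler01 lexx.
rewrite divr_ge0 ?subr_ge0 ?cd_beta_ge0//=.
have [->|b0] := eqVneq (cd_beta D) 0%R; first by rewrite invr0 mulr0.
by rewrite ler_pdivrMr ?mul1r// lt_neqAle eq_sym b0 cd_beta_ge0.
Qed.

Let keep01 : forall j, (0 <= keep j <= 1)%R := @keep_prob.

Let beta_keep : (cd_beta D * ((gamma - C) / cd_beta D) = gamma - C)%R.
Proof.
(* If [beta = 0], then [gamma = C] by [beta_gamma], and both sides are 0. *)
have [b0|b0] := eqVneq (cd_beta D) 0%R; last by rewrite mulrCA divff ?mulr1.
have := beta_gamma; rewrite b0 mul0r => gC.
by apply/esym/le_anti; rewrite gC subr_ge0.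
Qed.

Lemma content_mixture (w : 'I_k -> R) (v : R) A :
  \sum_j (extend_weights w v j * keep j)%:E * content j A =
  \sum_j (w j)%:E * density_prob (cd_Q D j) A
  + (v * ((gamma - C) / cd_beta D))%:E * density_prob e A.
Proof.
rewrite (bigD1_ord ord_max)//= addeC; congr (_ + _).
  by apply: eq_bigr => j _; rewrite /extend_weights /keep /content liftK mulr1.
by rewrite /extend_weights /keep /content unlift_none.
Qed.

(** Averaging over the labels turns the first user into an always kept sample of [r x] and each of
    the others into a sample of [omega] kept with probability [gamma]; the number of kept ones is
    then binomial. *)
Lemma clone_filling x (p : fdist R 'I_k.+1) :
  (forall A, measurable A ->
     \sum_j (p j * keep j)%:E * content j A = density_prob (r x) A) ->
  forall B, measurable B ->
  pbind (clone_pair D n (label_prob p)) (filling_kernel content keep01) B =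
  blanket_pair r n omega x B.
Proof.
move=> pE B mB; have mG := nnmeasurable_indexed_dirac R mB.
pose G := indexed_dirac R B.
rewrite /pbind /clone_pair ge0_integral_distribution//; last first.
  exact: measurable_fun_nat_tuple.
under eq_integral => t _.
  (* The histogram determines the labels up to order, so [labels] is replaced by the sampled tuple
     [t]. *)
  rewrite /= /filling_kernel /filling (perm_thins content keep01 mG (perm_labels t)).
  over.
pose q i := if i == ord0 :> 'I_n.+1 then p else
  extend_fdist (cd_c_ge0 D) (cd_beta_ge0 D) (cd_c_sum1 D).
pose g (i : 'I_n.+1) := if i == ord0 then 1%R else gamma.
pose rx : probability Y R := density_prob (r x).
pose rom : probability Y R := density_prob omega.
pose M (i : 'I_n.+1) := if i == ord0 then rx else rom.
rewrite /one_and_rest (_ : (fun i : 'I_n.+1 => _) = fun i => label_prob (q i)); last first.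
  by apply/funext => i; rewrite /q; case: eqP.
rewrite (@integral_label_thins _ _ _ _ keep content keep01 _ q g M)//; first last.
- move=> i F S mF; apply: thin_mixture => //.
    by rewrite /g; case: ifP => //; rewrite ler01 lexx.
  move=> A mA; rewrite /q /g /M; case: ifP => _; first by rewrite mul1e pE.
  by rewrite content_mixture beta_keep -eE.
- by move=> i; rewrite /g; case: ifP => //; rewrite ler01 lexx.
rewrite enum_ordSl /= (thins_map (lift ord0)).
have unit01 (u : unit) : (0 <= (1 : R) <= 1)%R by rewrite ler01 lexx.
have zero01 (j : 'I_n) : (0 <= (0 : R) <= 1)%R by rewrite ler01 lexx.
have expand S : thins (g \o lift ord0) (M \o lift ord0) (enum 'I_n) G S =
    \sum_(m < n.+1) (binomial_pmf n gamma m)%:E * samples (density_prob omega) m G S.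
  (* The operator of a thinned sample of [omega] is [gamma T] plus [1 - gamma] times the identity,
     here written as thinning with keep probability 0. *)
  rewrite (thins_expansion gamma01 zero01 (omega := density_prob omega)
    (P := fun=> density_prob omega))//; last first.
    by move=> j F S' mF; rewrite thin0E thin1E.
  rewrite size_enum_ord; apply: eq_bigr => m _.
  rewrite /samples -thinsZ//; last by rewrite lee_fin binomial_pmf_ge0.
  by apply: eq_thins => S'; rewrite expansion_coef_id// size_enum_ord.
rewrite (eq_thin _ _ _ expand) thin_sum//; last 3 first.
- by rewrite ler01 lexx.
- by move=> m; rewrite lee_fin binomial_pmf_ge0.
- by move=> m; exact: nnmeasurable_samples.
rewrite blanket_pairE//; apply: eq_bigr => m _; congr (_ * _).
rewrite /M/= -integral_one_and_rest//.
transitivity (\int[one_and_rest m (density_prob (r x)) (density_prob omega)]_t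
    (\1_(@sized_multiset _ Y m @^-1` B) t)%:E).
  apply: eq_integral => t _.
  by rewrite /G /indexed_dirac indexed_seq_mset diracE indicE.
rewrite integral_indic// ?setIT//.
by rewrite -[X in measurable X]setTI; exact: measurable_funPT.
Qed.

End clone_post_processing.

Theorem theorem6 (R : realType) (d : measure_display) (Y : measurableType d)
    (mu : {measure set Y -> \bar R}) (X : Type) (r : X -> density mu)
    (x0 x1 : X) (n k : nat) (D : clone_decomposition r x0 x1 k)
    (omega : density mu) :
  measurable_fun setT (blanket_inf r) ->
  is_blanket r omega ->
  (exists f : R.-pker (k.+1.-tuple nat) ~> (nat * mset_of Y)%type,
     (forall B, measurable B ->
        pbind (clone_pair D n (A0 D)) f B = blanket_pair r n omega x0 B) /\
     (forall B, measurable B ->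
        pbind (clone_pair D n (A1 D)) f B = blanket_pair r n omega x1 B)) /\
  (forall (eps : R) (xs : n.-tuple X), 0 <= eps ->
     (hockey_stick (expR eps)
        (shuffled r [tuple of x0 :: xs]) (shuffled r [tuple of x1 :: xs])
      <= hockey_stick (expR eps)
           (blanket_pair r n omega x0) (blanket_pair r n omega x1))%E /\
     (hockey_stick (expR eps)
        (blanket_pair r n omega x0) (blanket_pair r n omega x1)
      <= hockey_stick (expR eps)
           (clone_pair D n (A0 D)) (clone_pair D n (A1 D)))%E).
Proof.
move=> minf omegaP.
have [_ [e eE]] := blanket_clone minf omegaP D.
pose k01 := fun j => keep_prob D minf omegaP j.
(* Neither the keep probabilities nor the contents depend on the first user's label law, so one
   kernel treats both cases. *)
pose f : R.-pker (k.+1.-tuple nat) ~> (nat * mset_of Y)%type :=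
  filling_kernel (content D e) k01.
have f0 B : measurable B ->
    pbind (clone_pair D n (A0 D)) f B = blanket_pair r n omega x0 B.
  move=> mB; apply: (@clone_filling _ _ _ _ _ _ _ _ _ D omega n minf omegaP e eE)
    => [A mA|]; last exact: mB.
  (* Label [k+1] has weight 0 for the first user, which removes the term in [e]. *)
  rewrite content_mixture mul0r mul0e adde0.
  rewrite -density_prob_sum//; last exact: cd_a_ge0.
  by apply: eq_integral => y _; rewrite (cd_x0E D).
have f1 B : measurable B ->
    pbind (clone_pair D n (A1 D)) f B = blanket_pair r n omega x1 B.
  move=> mB; apply: (@clone_filling _ _ _ _ _ _ _ _ _ D omega n minf omegaP e eE)
    => [A mA|]; last exact: mB.
  rewrite content_mixture mul0r mul0e adde0.
  rewrite -density_prob_sum//; last exact: cd_b_ge0.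
  by apply: eq_integral => y _; rewrite (cd_x1E D).
split; first by exists f; exact: (conj f0 f1).
move=> eps xs _; split; apply: hockey_stick_data_processing => A mA.
  have [phi [mphi phi01 phiE]] := shuffled_blanket_test x0 minf omegaP xs mA.
  by exists phi; split=> //; exact: phiE.
(* The test is the probability that the post-processed histogram lies in [A]. *)
exists (f ^~ A); split.
- exact: measurable_kernel.
- move=> h; rewrite measure_ge0 /=.
  by rewrite -(@prob_kernel _ _ _ _ _ f h) le_measure// inE.
- exact/esym/f0.
- exact/esym/f1.
Qed.
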